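(* Let $\pi:\mathcal{E}\to\mathcal{M}$ be a smooth bundle. The holonomic lift $\xi\mapsto\xi^{hol}:=\Gamma_{\mathbf J}(\xi)=(\pi_*\xi)^{hol}$ is a Lie algebra isomorphism from the space of projectable vector fields in $\mathfrak{X}(\mathcal{E})$ (with the Jacobi--Lie bracket $[\ ,\ ]$) into $J^1\pi\times_{\mathcal{E}}T\mathcal{E}$, i.e. into the first order generalized vector fields with the bracket $[\ ,\ ]_{pro}$ (an isomorphism onto its image); in particular, for all projectable $\xi,\eta\in\mathfrak{X}(\mathcal{E})$, $$[\Gamma_{\mathbf J}(\xi),\Gamma_{\mathbf J}(\eta)]_{pro}=[\xi^{hol},\eta^{hol}]_{pro}=[\xi,\eta]^{hol}=\Gamma_{\mathbf J}([\xi,\eta]).$$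
   Context: Let $(x^a)$, $1\le a\le m$, be local coordinates on $\mathcal{M}$, $(x^a,u^\lambda)$ bundle coordinates on $\mathcal{E}$, and $(x^a,u^\lambda,u^\lambda_a)$ the induced coordinates on the first jet manifold $J^1\pi$, where $u^\lambda_a(j^1_x\phi)=\partial\phi^\lambda/\partial x^a|_x$ for a section $\phi$; $u^\lambda_{ab}$ are the second order jet coordinates. Let $\pi_0:J^1\pi\to\mathcal{E}$, $j^1_x\phi\mapsto\phi(x)$. A generalized vector field of order one (required to be projectable) is a section of the pull-back bundle $\pi_0^*(T\mathcal{E})=J^1\pi\times_{\mathcal{E}}T\mathcal{E}\to J^1\pi$, of the form $\xi(j^1_x\phi)=\xi^a(x)\,\partial/\partial x^a+\xi^\lambda(j^1_x\phi)\,\partial/\partial u^\lambda$. Its first prolongation is $$pr^1\xi=\xi+\Phi^\lambda_a\frac{\partial}{\partial u^\lambda_a},\qquad \Phi^\lambda_a=D_{x^a}(\xi^\lambda-\xi^bu^\lambda_b)+\xi^bu^\lambda_{ba},$$ with $D_{x^a}$ the total derivative. The bracket of two such fields is $$[\xi,\eta]_{pro}=\big(pr^1\xi(\eta^a)-pr^1\eta(\xi^a)\big)\frac{\partial}{\partial x^a}+\big(pr^1\xi(\eta^\lambda)-pr^1\eta(\xi^\lambda)\big)\frac{\partial}{\partial u^\lambda}.$$ A vector field $\xi$ on $\mathcal{E}$ is projectable if it is $\pi$-related to a vector field $\pi_*\xi$ on $\mathcal{M}$. For $X=X^a(x)\,\partial/\partial x^a\in\mathfrak{X}(\mathcal{M})$,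 the holonomic lift is the generalized vector field $X^{hol}(j^1_x\phi)=T\phi(X(x))$, i.e. $$X^{hol}=X^a\frac{\partial}{\partial x^a}+X^au^\lambda_a\frac{\partial}{\partial u^\lambda}.$$ The connection tensor is $\Gamma_{\mathbf J}=dx^a\otimes\big(\partial/\partial x^a+u^\lambda_a\,\partial/\partial u^\lambda\big)$, so that $\Gamma_{\mathbf J}(\xi)=(\pi_*\xi)^{hol}$ for projectable $\xi$.
   Formalization: The lift kills vertical fields (e.g. ∂/∂u on R×R→R), so it is not injective on projectable fields; the formal theorem states a Lie algebra homomorphism with kernel the vertical fields, and a Lie algebra isomorphism from the projections π_*ξ onto the image. *)

(* Defs.v *)
From HB Require Import structures.
From mathcomp Require Import all_boot all_order all_algebra.
From mathcomp Require Import all_classical all_reals all_analysis.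

Set Implicit Arguments.
Unset Strict Implicit.
Unset Printing Implicit Defensive.

Import Order.TTheory GRing.Theory Num.Theory.
Import numFieldNormedType.Exports.

Local Open Scope classical_set_scope.
Local Open Scope ring_scope.

(** * Smooth functions between finite-dimensional normed spaces *)

(* Only meant for open [U]; in finite dimension this is the usual C^r class,
   and the values of [f] outside [U] are irrelevant. *)
Fixpoint C_on (R : realType) (V W : normedModType R) (r : nat) (U : set V)
    (f : V -> W) : Prop :=
  if r is r'.+1 then
    (forall x, U x -> differentiable f x) /\
    (forall v, C_on r' U (fun x => 'D_v f x))
  else forall x, U x -> {for x, continuous f}.

Definition smooth_on (R : realType) (V W : normedModType R) (U : set V)
    (f : V -> W) : Prop :=
  forall r, C_on r U f.

(** * Manifolds *)

(* [cmap] and [cinv] are total functions; only their restrictions to [cdom]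
   and to [cmap @` cdom] are meaningful. *)
Record chart (R : realType) (n : nat) (T : topologicalType) := Chart {
  cdom : set T;
  cmap : T -> 'rV[R]_n;
  cinv : 'rV[R]_n -> T }.

Definition is_chart (R : realType) (n : nat) (T : topologicalType)
    (c : chart R n T) : Prop :=
  [/\ open (cdom c),
      open (cmap c @` cdom c),
      forall p, cdom c p -> cinv c (cmap c p) = p,
      forall p, cdom c p -> {for p, continuous (cmap c)} &
      forall p, cdom c p -> {for cmap c p, continuous (cinv c)}].

Definition compatible (R : realType) (n : nat) (T : topologicalType)
    (c c' : chart R n T) : Prop :=
  let W := cdom c `&` cdom c' in
  smooth_on (cmap c @` W) (cmap c' \o cinv c) /\
  smooth_on (cmap c' @` W) (cmap c \o cinv c').

Record manifold (R : realType) (n : nat) := Manifold {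
  mcarrier :> topologicalType;
  atlas : set (chart R n mcarrier);
  _ : hausdorff_space mcarrier;
  _ : @second_countable mcarrier;
  _ : forall c, atlas c -> is_chart c;
  _ : forall p : mcarrier, exists2 c, atlas c & cdom c p;
  _ : forall c c', atlas c -> atlas c' -> compatible c c';
  _ : forall c, is_chart c -> (forall c', atlas c' -> compatible c c') ->
        atlas c }.

Definition chart_at (R : realType) (n : nat) (M : manifold R n) (p : M)
    (c : chart R n M) : Prop :=
  atlas c /\ cdom c p.

Definition local_rep (R : realType) (m n : nat) (M : manifold R m)
    (N : manifold R n) (c : chart R m M) (c' : chart R n N) (f : M -> N) :
    'rV[R]_m -> 'rV[R]_n :=
  fun y => cmap c' (f (cinv c y)).

(* Required at all points of an open set, this is smoothness of [f] there. *)
Definition smooth_at (R : realType) (m n : nat) (M : manifold R m)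
    (N : manifold R n) (f : M -> N) (p : M) : Prop :=
  {for p, continuous f} /\
  forall c c', chart_at p c -> chart_at (f p) c' ->
    exists V, [/\ open V, V (cmap c p) & smooth_on V (local_rep c c' f)].

Definition smooth_map (R : realType) (m n : nat) (M : manifold R m)
    (N : manifold R n) (f : M -> N) : Prop :=
  forall p, smooth_at f p.

(* Smoothness of a map defined on a product manifold, in product charts. *)
Definition smooth2_at (R : realType) (m k n : nat) (M : manifold R m)
    (F : manifold R k) (N : manifold R n) (g : M -> F -> N) (x : M) (y : F) :
    Prop :=
  {for (x, y), continuous (fun z : M * F => g z.1 z.2)} /\
  forall c d c', chart_at x c -> chart_at y d -> chart_at (g x y) c' ->
    exists V : set ('rV[R]_m * 'rV[R]_k)%type,
      [/\ open V, V (cmap c x, cmap d y) &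
          smooth_on V (fun z => cmap c' (g (cinv c z.1) (cinv d z.2)))].

(** * Vector fields *)

(* A tangent vector at [p] is the family of its components in all charts at
   [p], extended by 0 to the other charts so that equality of tangent vectors
   is equality of functions. *)
Notation tvec R n M := (chart R n M -> 'rV[R]_n).

Definition tangent (R : realType) (n : nat) (M : manifold R n) (p : M)
    (v : tvec R n M) : Prop :=
  (forall c, ~ chart_at p c -> v c = 0) /\
  (forall c c', chart_at p c -> chart_at p c' ->
     v c' = 'd (local_rep c c' id) (cmap c p) (v c)).

Definition vfield (R : realType) (n : nat) (M : manifold R n) :
    set (M -> tvec R n M) :=
  [set X | (forall p, tangent p (X p)) /\
           (forall c, atlas c ->
              smooth_on (cmap c @` cdom c) (fun y => X (cinv c y) c))].

(* [X^j d_j Y^i - Y^j d_j X^i] in each chart. *)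
Definition lie_bracket (R : realType) (n : nat) (M : manifold R n)
    (X Y : M -> tvec R n M) : M -> tvec R n M :=
  fun p c =>
    if `[< chart_at p c >] then
      'D_(X p c) (fun y => Y (cinv c y) c) (cmap c p)
      - 'D_(Y p c) (fun y => X (cinv c y) c) (cmap c p)
    else 0.

(* [T f (X p) = Y (f p)] for all [p]. *)
Definition related (R : realType) (m n : nat) (M : manifold R m)
    (N : manifold R n) (f : M -> N) (X : M -> tvec R m M)
    (Y : N -> tvec R n N) : Prop :=
  forall p c c', chart_at p c -> chart_at (f p) c' ->
    Y (f p) c' = 'd (local_rep c c' f) (cmap c p) (X p c).

(** * Lie algebras *)

Definition lie_algebra (R : realType) (V : lmodType R) (S : set V)
    (br : V -> V -> V) : Prop :=
  [/\ S 0 /\ (forall (a : R) x y, S x -> S y -> S (a *: x + y)),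
      forall x y, S x -> S y -> S (br x y),
      forall (a : R) x y z, S x -> S y -> S z ->
        br (a *: x + y) z = a *: br x z + br y z /\
        br z (a *: x + y) = a *: br z x + br z y,
      forall x, S x -> br x x = 0 &
      forall x y z, S x -> S y -> S z ->
        br x (br y z) + br y (br z x) + br z (br x y) = 0].

Definition lie_homomorphism (R : realType) (V W : lmodType R) (S : set V)
    (brV : V -> V -> V) (brW : W -> W -> W) (f : V -> W) : Prop :=
  (forall (a : R) x y, S x -> S y -> f (a *: x + y) = a *: f x + f y) /\
  (forall x y, S x -> S y -> f (brV x y) = brW (f x) (f y)).

Definition lie_isomorphism (R : realType) (V W : lmodType R) (S : set V)
    (brV : V -> V -> V) (T : set W) (brW : W -> W -> W) (f : V -> W) : Prop :=
  [/\ lie_algebra S brV, lie_algebra T brW, lie_homomorphism S brV brW f &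
      set_bij S T f].

(** * Smooth bundles *)

(* [e |-> (pi e, pr e)] and [(x, y) |-> glue x y] are inverse diffeomorphisms
   between [pi^-1 U] and [U x F]. *)
Definition local_trivialization (R : realType) (m k : nat) (M : manifold R m)
    (E : manifold R (m + k)) (F : manifold R k) (pi : E -> M) (U : set M)
    (pr : E -> F) (glue : M -> F -> E) : Prop :=
  [/\ open U,
      forall e, U (pi e) -> smooth_at pr e,
      forall x y, U x -> smooth2_at glue x y,
      forall x y, U x -> pi (glue x y) = x /\ pr (glue x y) = y &
      forall e, U (pi e) -> glue (pi e) (pr e) = e].

Definition smooth_bundle (R : realType) (m k : nat) (M : manifold R m)
    (E : manifold R (m + k)) (pi : E -> M) : Prop :=
  [/\ smooth_map pi,
      forall x, exists e, pi e = x &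
      exists F : manifold R k, forall x, exists U pr glue,
        U x /\ @local_trivialization R m k M E F pi U pr glue].

Section Bundle.
Variables (R : realType) (m k : nat).
Variables (M : manifold R m) (E : manifold R (m + k)) (pi : E -> M).

Definition projectable : set (E -> tvec R (m + k) E) :=
  [set xi | vfield xi /\ exists2 X, vfield X & related pi xi X].

(* [pi_* xi]; unique for projectable [xi] since [pi] is surjective. *)
Definition base_field (xi : E -> tvec R (m + k) E) :
    M -> tvec R m M :=
  xget 0 [set X | vfield X /\ related pi xi X].

Definition vertical (xi : E -> tvec R (m + k) E) : Prop :=
  related pi xi 0.

(* Bundle coordinates [(x^a, u^lambda)] together with the underlying
   coordinates [(x^a)] of the base. *)
Record bchart := BChart {
  btot : chart R (m + k) E;
  bbase : chart R m M }.

Definition is_bchart (b : bchart) : Prop :=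
  [/\ atlas (btot b), atlas (bbase b) &
      forall e, cdom (btot b) e ->
        cdom (bbase b) (pi e) /\ lsubmx (cmap (btot b) e) = cmap (bbase b) (pi e)].

(** * Jets *)

(* A pair [(x, phi)] representing the jets [j^r_x phi]. *)
Record lsection := LSection {
  foot : M;
  sect : M -> E;
  sectP : exists U, [/\ open U, U foot,
            forall x, U x -> smooth_at sect x &
            forall x, U x -> pi (sect x) = x] }.

Definition bchart_at (b : bchart) (s : lsection) : Prop :=
  is_bchart b /\ cdom (btot b) (sect s (foot s)).

(* [j^1_x phi = j^1_x psi]: same point, value and tangent map. *)
Definition same_jet1 (s t : lsection) : Prop :=
  [/\ foot s = foot t,
      sect s (foot s) = sect t (foot t) &
      forall c c', chart_at (foot s) c -> chart_at (sect s (foot s)) c' ->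
        forall v, 'd (local_rep c c' (sect s)) (cmap c (foot s)) v =
                  'd (local_rep c c' (sect t)) (cmap c (foot s)) v].

(* [phi^lambda] as a function of the [x^a] *)
Definition sect_fib (b : bchart) (s : lsection) : 'rV[R]_m -> 'rV[R]_k :=
  fun y => rsubmx (local_rep (bbase b) (btot b) (sect s) y).

(* [u^l_a] *)
Definition ju1 (b : bchart) (s : lsection) : 'M[R]_(m, k) :=
  \matrix_(a, l) ('D_(delta_mx 0 a) (sect_fib b s) (cmap (bbase b) (foot s))) 0 l.

(* [u^l_ac] *)
Definition ju2 (b : bchart) (s : lsection) (a c : 'I_m) (l : 'I_k) : R :=
  ('D_(delta_mx 0 c) (fun y => 'D_(delta_mx 0 a) (sect_fib b s) y)
     (cmap (bbase b) (foot s))) 0 l.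

(* [((x^a, u^l), u^l_a)] *)
Definition jcoord (b : bchart) (s : lsection) : 'rV[R]_(m + k) * 'M[R]_(m, k) :=
  (cmap (btot b) (sect s (foot s)), ju1 b s).

(* The function [F] of 1-jets read in the induced coordinates of [J^1 pi];
   when [F] depends only on 1-jets, the choice of a representative [s] is
   immaterial. *)
Definition jrep (W : zmodType) (b : bchart) (F : lsection -> W)
    (q : 'rV[R]_(m + k) * 'M[R]_(m, k)) : W :=
  if pselect (exists s, bchart_at b s /\ jcoord b s = q) is left h
  then F (projT1 (cid h)) else 0.

(** * Generalized vector fields *)

(* [xi s b] is the row of components [(xi^a, xi^lambda)] in the bundle chart
   [b] of a vector tangent to [E] at the value of [s]. Functions on
   [J^r pi] are functions of local sections that depend only on the r-jet,
   so that the pull-back from [J^1 pi] to [J^2 pi] is implicit. *)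
Local Notation gfield := (lsection -> bchart -> 'rV[R]_(m + k)).

Definition generalized_field (xi : gfield) : Prop :=
  [/\ (forall s b, ~ bchart_at b s -> xi s b = 0) /\
      (forall s b b', bchart_at b s -> bchart_at b' s ->
         xi s b' = 'd (local_rep (btot b) (btot b') id)
                     (cmap (btot b) (sect s (foot s))) (xi s b)),
      forall s t, same_jet1 s t -> xi s = xi t,
      exists2 X : M -> tvec R m M, vfield X &
        forall s b, bchart_at b s -> lsubmx (xi s b) = X (foot s) (bbase b) &
      forall b, is_bchart b ->
        smooth_on [set q | (cmap (btot b) @` cdom (btot b)) q.1]
          (jrep b (fun s => xi s b))].

Implicit Types (xi eta : gfield).

(* The coordinate derivations [d/dx^a], [d/du^l] and [d/du^l_a]. *)
Definition pdx (f : 'rV[R]_(m + k) * 'M[R]_(m, k) -> R) (a : 'I_m) q : R :=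
  'D_(row_mx (delta_mx 0 a) 0, 0) f q.
Definition pdu (f : 'rV[R]_(m + k) * 'M[R]_(m, k) -> R) (l : 'I_k) q : R :=
  'D_(row_mx 0 (delta_mx 0 l), 0) f q.
Definition pdu1 (f : 'rV[R]_(m + k) * 'M[R]_(m, k) -> R) (a : 'I_m) (l : 'I_k)
    q : R :=
  'D_(0, delta_mx a l) f q.

(* [D_{x^a} f] at the 2-jet of [s] *)
Definition total_derivative (b : bchart) (s : lsection)
    (f : 'rV[R]_(m + k) * 'M[R]_(m, k) -> R) (a : 'I_m) : R :=
  let q := jcoord b s in
  pdx f a q
  + \sum_(l < k) ju1 b s a l * pdu f l q
  + \sum_(c < m) \sum_(l < k) ju2 b s c a l * pdu1 f c l q.

(* [xi^l - xi^c u^l_c] as a function of the coordinates of [J^1 pi] *)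
Definition characteristic (b : bchart) xi (l : 'I_k)
    (q : 'rV[R]_(m + k) * 'M[R]_(m, k)) : R :=
  let v := jrep b (fun s => xi s b) q in
  v 0 (rshift m l) - \sum_(c < m) v 0 (lshift k c) * q.2 c l.

(* [Phi^l_a] *)
Definition prol_coef (b : bchart) xi (s : lsection) (a : 'I_m) (l : 'I_k) : R :=
  total_derivative b s (characteristic b xi l) a
  + \sum_(c < m) xi s b 0 (lshift k c) * ju2 b s c a l.

(* [pr^1 xi (f)] at the 2-jet of [s] *)
Definition prolongation (b : bchart) xi (s : lsection)
    (f : 'rV[R]_(m + k) * 'M[R]_(m, k) -> R) : R :=
  let q := jcoord b s in
  \sum_(a < m) xi s b 0 (lshift k a) * pdx f a q
  + \sum_(l < k) xi s b 0 (rshift m l) * pdu f l q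
  + \sum_(a < m) \sum_(l < k) prol_coef b xi s a l * pdu1 f a l q.

Definition pro_bracket xi eta : gfield :=
  fun s b =>
    if `[< bchart_at b s >] then
      \row_i (prolongation b xi s (fun q => jrep b (fun t => eta t b) q 0 i)
              - prolongation b eta s (fun q => jrep b (fun t => xi t b) q 0 i))
    else 0.

(* [X^hol (j^1_x phi) = T phi (X x)] *)
Definition hol (X : M -> tvec R m M) :
    gfield :=
  fun s b =>
    if `[< bchart_at b s >] then
      'd (local_rep (bbase b) (btot b) (sect s)) (cmap (bbase b) (foot s))
        (X (foot s) (bbase b))
    else 0.

(* Contraction with [dx^a (x) (d/dx^a + u^l_a d/du^l)]. *)
Definition GammaJ (xi : E -> tvec R (m + k) E) :
    gfield :=
  fun s b =>
    if `[< bchart_at b s >] then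
      let v := lsubmx (xi (sect s (foot s)) (btot b)) in
      row_mx v (v *m ju1 b s)
    else 0.

End Bundle.

Arguments lie_bracket {R n M} X Y.
Arguments pro_bracket {R m k M E} pi xi eta.
Arguments hol {R m k M E} pi X.
Arguments GammaJ {R m k M E} pi xi.
Arguments generalized_field {R m k M E} pi xi.

(* Main.v *)
Require Import Defs.
From HB Require Import structures.
From mathcomp Require Import all_boot all_order all_algebra.
From mathcomp Require Import all_classical all_reals all_analysis.
From mathcomp Require Import ring.

Set Implicit Arguments.
Unset Strict Implicit.
Unset Printing Implicit Defensive.

Import Order.TTheory GRing.Theory Num.Theory.
Import numFieldNormedType.Exports.

Local Open Scope classical_set_scope.
Local Open Scope ring_scope.

(* The holonomic lift depends on [xi] only through [X = pi_* xi], and in bundle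
   coordinates it is [(X^a, X^a u^l_a)]. Its characteristic
   [X^a u^l_a - X^a u^l_a] vanishes identically, so the prolongation coefficients
   reduce to [X^c u^l_ca]. Hence the fibre components of the bracket of the lifts
   of [X] and [Y] are [[X, Y]^a u^l_a + Y^a X^c u^l_ca - X^a Y^c u^l_ca], and the
   second order terms cancel because [u^l_ca] is symmetric. Relatedness is stable
   under Lie brackets, so [pi_*] is a homomorphism; the lift is injective on base
   fields since the [X^a] can be read off at a 1-jet over each point. Such jets
   exist because local trivializations provide bundle charts everywhere, in which
   affine sections realize any prescribed 1-jet. *)

(** * Differentiation and symmetry of second derivatives *)

(** [GammaJ] is not injective: it kills exactly the vertical fields. The isomorphism onto the image
    is therefore one of [hol] on projected fields, and the kernel of [GammaJ] is computed
    separately. For general first order fields the prolongation brings in second derivatives, so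
    that their bracket need not be of first order again. The Lie algebra laws of [pro_bracket] are
    therefore established on the image of the lift alone, by transport along the homomorphism
    [GammaJ] from the projectable fields. Chart maps and their inverses are total functions that
    mean something on their domains only. Identities between local representatives hold merely near
    a point, hence the systematic use of germs: smoothness near a point, and derivatives compared
    through equality on a neighbourhood. *)

Section scale.
Context {R : realType} {W : normedModType R}.

Lemma scale_is_bilinear :
  bilinear_for (GRing.Scale.Law.clone _ _ *:%R _)
    (GRing.Scale.Law.clone _ _ *:%R _) (@GRing.scale R W).
Proof.
split=> [u|u] a x y /=; first by rewrite scalerDl scalerA.
by rewrite scalerDr !scalerA mulrC.
Qed.

Let scaleM := bilinear_isBilinear.Build R R W W _ _ (@GRing.scale R W)
  scale_is_bilinear.

(** Bundled as a bilinear map, so that the Leibniz rule for [a z *: f z] follows from the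
    differential of a bilinear map. *)
Definition scale_bilinear : {bilinear R -> W -> W} :=
  HB.pack (@GRing.scale R W) scaleM.

Lemma scale_cont : continuous (fun p : R * W => scale_bilinear p.1 p.2).
Proof. exact: scale_continuous. Qed.

End scale.
Arguments scale_bilinear : clear implicits.
Arguments scale_cont : clear implicits.

Section differential.
Context {R : realType} {V W : normedModType R}.
Implicit Types (f g : V -> W) (x v : V).

(** Write [g = f + (g - f)]: the second summand vanishes near [x], so its differential there is
    0. *)
Lemma near_eq_differentiable f g x :
  {near x, f =1 g} -> differentiable f x -> differentiable g x.
Proof.
move=> fg df.
have -> : g = f + (g - f) by rewrite addrC subrK.
apply: (differentiableD df).
have e0 : \forall h \near 0, (g - f) (h + x) = 0.
  have : \forall z \near x, (g - f) z = 0.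
    near=> z; apply/eqP; rewrite subr_eq0; apply/eqP/esym.
    by near: z.
  by rewrite (near_shift 0 x) subr0.
have lo : (g - f) \o shift x = cst ((g - f) x) + (\0 : V -> W) +o_ 0 id.
  apply/eqaddoP => e e0'; near=> h.
  have eh : (g - f) (h + x) = 0 by near: h.
  have ex : (g - f) x = 0 by have := nbhs_singleton e0; rewrite add0r.
  rewrite [X in `|X|](_ : _ = (g - f) (h + x) - ((g - f) x + 0)) //.
  rewrite eh ex addr0 subr0.
  by rewrite normr0 mulr_ge0// ltW.
have c0 : continuous (\0 : V -> W) by move=> z; exact: cvg_cst.
have := @diff_unique _ _ _ _ (\0 : {linear V -> W}) _ c0 lo => d0.
by apply/diff_locallyP; rewrite d0.
Unshelve. all: by end_near. Qed.

Lemma near_eq_diff f g x : differentiable f x ->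
  {near x, f =1 g} -> 'd g x = 'd f x :> (V -> W).
Proof.
move=> df fg; have dg := near_eq_differentiable fg df.
apply/funext => v; rewrite -!deriveE //; apply: near_eq_derive.
by near do apply/esym.
Unshelve. all: by end_near. Qed.

Lemma linear_derive f x v : linear f -> continuous f ->
  differentiable f x /\ 'D_v f x = f v.
Proof.
move=> lf cf.
pose fM := GRing.isLinear.Build _ _ _ _ _ lf.
pose fL : {linear _ -> _} := HB.pack f fM.
have df : differentiable f x by exact: (@linear_differentiable _ _ _ fL).
by split => //; rewrite deriveE // (@diff_lin _ _ _ fL).
Qed.

Lemma differentiable_scale (a : V -> R) f x :
  differentiable a x -> differentiable f x ->
  differentiable (fun z => a z *: f z) x.
Proof.
move=> da df.
have := @differentiable_comp _ _ _ _ (fun z => (a z, f z)) _ x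
  (differentiable_pair da df)
  (differentiable_bilin (f := scale_bilinear R W) _ (scale_cont R W)).
exact.
Qed.

Lemma derive_scale (a : V -> R) f x v :
  differentiable a x -> differentiable f x ->
  'D_v (fun z => a z *: f z) x = 'D_v a x *: f x + a x *: 'D_v f x.
Proof.
move=> da df.
have dp := differentiable_pair da df.
have ds := differentiable_bilin (f := scale_bilinear R W) (a x, f x) (scale_cont R W).
rewrite deriveE; last exact: (differentiable_comp dp ds).
rewrite (diff_comp dp ds) /= (diff_bilin _ (scale_cont R W)) /= diff_pair //=.
by rewrite !deriveE // addrC.
Qed.

(** The two difference quotients are the same function of [h]. Directional derivatives thus become
    derivatives in one variable, to which the mean value theorem applies. *)
Lemma derive_line f x v (t : R) : derivable f (x + t *: v) v ->
  is_derive t 1 (fun s : R => f (x + s *: v)) ('D_v f (x + t *: v)).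
Proof.
move=> df.
have E : (fun h : R => h^-1 *: (((fun s : R => f (x + s *: v)) \o shift t) (h *: 1)
            - f (x + t *: v)))
        = (fun h => h^-1 *: ((f \o shift (x + t *: v)) (h *: v) - f (x + t *: v))).
  apply/funext => h /=; congr (_ *: (f _ - _)).
  by rewrite [h *: 1]mulr1 scalerDl addrCA.
by split; rewrite /derivable /derive E.
Qed.

End differential.

Lemma derive_comp (R : realType) (V W X : normedModType R) (f : V -> W)
    (g : W -> X) x v : differentiable f x -> differentiable g (f x) ->
  'D_v (g \o f) x = 'D_('D_v f x) g (f x).
Proof.
move=> df dg; rewrite deriveE; last exact: differentiable_comp.
by rewrite diff_comp //= -!deriveE.
Qed.

Section schwarz.
Context {R : realType} {V : normedModType R}.
Implicit Types (f : V -> R) (x v w : V).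

(** The mean value theorem is used twice: along [v] for the increment of [f] over [d *: w], then
    along [w] for ['D_v f] at the intermediate parameter. *)
Lemma second_difference f x v w (d : R) : 0 < d ->
  (forall s t, 0 <= s <= d -> 0 <= t <= d ->
     derivable f (x + s *: v + t *: w) v /\
     derivable ('D_v f) (x + s *: v + t *: w) w) ->
  exists s t, [/\ 0 <= s <= d, 0 <= t <= d &
    f (x + d *: v + d *: w) - f (x + d *: v) - (f (x + d *: w) - f x) =
      d * (d * 'D_w ('D_v f) (x + s *: v + t *: w))].
Proof.
move=> d0 H.
have H0 : (0 : R) <= 0 <= d by rewrite lexx ltW.
have Hd : 0 <= d <= d by rewrite lexx ltW.
pose g s := f (x + d *: w + s *: v) - f (x + s *: v).
pose g' s := 'D_v f (x + s *: v + d *: w) - 'D_v f (x + s *: v).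
have dg s : 0 <= s <= d -> is_derive s 1 g (g' s).
  move=> sd; rewrite /g' [x + s *: v + _]addrAC; apply: is_deriveB.
    apply: derive_line; rewrite addrAC; exact: (proj1 (H _ _ sd Hd)).
  apply: derive_line; have := proj1 (H _ _ sd H0).
  rewrite scale0r addr0; exact.
have [s sI Es] : exists2 s, s \in `]0, d[%R & g d - g 0 = g' s * (d - 0).
  apply: (@MVT _ g g' _ _ d0) => [s|].
    by rewrite in_itv /= => /andP[s0 sd]; apply: dg; rewrite !ltW.
  apply: derivable_within_continuous => s; rewrite in_itv /= => /dg ds.
  exact: ex_derive.
have sd : 0 <= s <= d by move: sI; rewrite in_itv /= => /andP[? ?]; rewrite !ltW.
pose h t := 'D_v f (x + s *: v + t *: w).
have dh t : 0 <= t <= d -> is_derive t 1 h ('D_w ('D_v f) (x + s *: v + t *: w)).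
  by move=> td; apply: derive_line; exact: (proj2 (H _ _ sd td)).
have [t tI Et] : exists2 t, t \in `]0, d[%R &
    h d - h 0 = 'D_w ('D_v f) (x + s *: v + t *: w) * (d - 0).
  apply: (@MVT _ h (fun t => 'D_w ('D_v f) (x + s *: v + t *: w)) _ _ d0).
    by move=> t; rewrite in_itv /= => /andP[t0 td]; apply: dh; rewrite !ltW.
  apply: derivable_within_continuous => t; rewrite in_itv /= => /dh dt.
  exact: ex_derive.
exists s, t; split => //.
  by move: tI; rewrite in_itv /= => /andP[? ?]; rewrite !ltW.
rewrite [x + d *: v + _]addrAC.
move: Es; rewrite /g !scale0r !addr0 => ->.
by move: Et; rewrite /g' /h scale0r addr0 subr0 mulrC => ->; rewrite [_ * d]mulrC.
Qed.

(** The second difference over the parallelogram on [d *: v] and [d *: w] is symmetric in [v] and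
    [w]. Hence the two mixed derivatives share a value, taken at possibly different points of the
    parallelogram, and continuity at [x] brings both points back to [x]. *)
Lemma derive_comm_real f x v w :
  (\forall z \near x, [/\ derivable f z v, derivable f z w,
     derivable ('D_v f) z w & derivable ('D_w f) z v]) ->
  {for x, continuous ('D_w ('D_v f))} -> {for x, continuous ('D_v ('D_w f))} ->
  'D_w ('D_v f) x = 'D_v ('D_w f) x.
Proof.
move=> df cwv cvw; apply/eqP; rewrite -subr_eq0 -normr_le0.
apply/ler_addgt0Pr => e e0; rewrite add0r.
have e2 : 0 < e / 2 by rewrite divr_gt0.
move/cvgrPdist_lt : cwv => /(_ _ e2) cwv.
move/cvgrPdist_lt : cvw => /(_ _ e2) cvw.
have /nbhs_ballP[r /= r0 rH] : \forall z \near x,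
  [/\ derivable f z v /\ derivable ('D_v f) z w,
      derivable f z w /\ derivable ('D_w f) z v,
      `|'D_w ('D_v f) x - 'D_w ('D_v f) z| < e / 2 &
      `|'D_v ('D_w f) x - 'D_v ('D_w f) z| < e / 2].
  apply: filterS3 df cwv cvw => z [d1 d2 d3 d4] n1 n2.
  split; [split; assumption|split; assumption|exact: n1|exact: n2].
(* With this [d] the parallelogram lies in the ball of radius [r]. The summand 1 keeps the
   denominator positive when [v = w = 0] and makes the final inequality strict. *)
pose d := r / (`|v| + `|w| + 1).
have n0 : 0 < `|v| + `|w| + 1 by rewrite ltr_wpDl // addr_ge0.
have d0 : 0 < d by rewrite divr_gt0.
have inB s t : 0 <= s <= d -> 0 <= t <= d -> ball x r (x + s *: v + t *: w).
  move=> /andP[s0 sd] /andP[t0 td].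
  rewrite -ball_normE /= -addrA opprD addNKr normrN.
  apply: (le_lt_trans (ler_normD _ _)); rewrite !normrZ !ger0_norm //.
  apply: (@le_lt_trans _ _ (d * (`|v| + `|w|))).
    by rewrite mulrDr lerD // ler_wpM2r.
  rewrite /d mulrAC ltr_pdivrMr // ltr_pM2l //.
  by rewrite ltrDl.
have [|s1 [t1 [s1d t1d E1]]] := @second_difference f x v w d d0.
  by move=> s t sd td; have [H _ _ _] := rH _ (inB _ _ sd td); exact: H.
have [|s2 [t2 [s2d t2d E2]]] := @second_difference f x w v d d0.
  move=> s t sd td; rewrite addrAC.
  by have [_ H _ _] := rH _ (inB _ _ td sd); exact: H.
rewrite [x + s2 *: w + _]addrAC in E2.
have [_ _ H1 _] := rH _ (inB _ _ s1d t1d).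
have [_ _ _ H2] := rH _ (inB _ _ t2d s2d).
have E : 'D_w ('D_v f) (x + s1 *: v + t1 *: w)
       = 'D_v ('D_w f) (x + t2 *: v + s2 *: w).
  have d0' : d != 0 by rewrite gt_eqF.
  apply: (mulfI d0'); apply: (mulfI d0').
  apply: (etrans (esym E1)); apply: (etrans _ E2).
  rewrite [x + d *: w + d *: v]addrAC.
  have sub4 (a b c u : R) : a - b - (c - u) = a - c - (b - u).
    by rewrite !opprB addrACA [RHS]addrACA [- c - b]addrC.
  exact: sub4.
rewrite -(subrKA ('D_w ('D_v f) (x + s1 *: v + t1 *: w))).
apply: (le_trans (ler_normD _ _)).
rewrite [leRHS](splitr e); apply: lerD; first exact: ltW H1.
rewrite distrC E; exact: ltW H2.
Qed.

End schwarz.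

(** * Smooth maps between normed spaces *)

Section linear_maps.
Context {R : realType}.

Lemma linear_mx_sum m n (W : lmodType R) (f : 'M[R]_(m, n) -> W) A :
  linear f -> f A = \sum_i \sum_j A i j *: f (delta_mx i j).
Proof.
move=> lf.
pose fM := GRing.isLinear.Build _ _ _ _ _ lf.
pose fL : {linear _ -> _} := HB.pack f fM.
rewrite -[f]/(fL : _ -> _) {1}[A]matrix_sum_delta linear_sum.
by apply: eq_bigr => i _; rewrite linear_sum; apply: eq_bigr => j _; rewrite linearZ.
Qed.

Lemma linear_mx_continuous m n (W : normedModType R) (f : 'M[R]_(m, n) -> W) :
  linear f -> continuous f.
Proof.
move=> lf.
have -> : f = (fun x => \sum_i \sum_j x i j *: f (delta_mx i j)).
  by apply/funext => x; exact: linear_mx_sum.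
apply: continuous_big => [|i _]; first exact: add_continuous.
apply: continuous_big => [|j _ x]; first exact: add_continuous.
by apply: cvgZr_tmp; [exact: nbhs_filter|exact: (@coord_continuous R m n i j x)].
Qed.

Lemma derive_delta n (W : normedModType R) (f : 'rV[R]_n -> W) x v :
  differentiable f x -> 'D_v f x = \sum_i v 0 i *: 'D_(delta_mx 0 i) f x.
Proof.
move=> df; rewrite deriveE // [in LHS](row_sum_delta v) linear_sum.
by apply: eq_bigr => i _; rewrite linearZ deriveE.
Qed.

Lemma differentiable_linear (V W X : normedModType R) (f : V -> W) (L : W -> X) x v :
  linear L -> continuous L -> differentiable f x ->
  differentiable (L \o f) x /\ 'D_v (L \o f) x = L ('D_v f x).
Proof.
move=> lL cL df; have [dL _] := linear_derive (f x) ('D_v f x) lL cL.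
split; first exact: differentiable_comp.
by rewrite derive_comp //; have [] := linear_derive (f x) ('D_v f x) lL cL.
Qed.

End linear_maps.

(** * Functions of class C^r on a set *)

Section C_on.
Context {R : realType}.
Implicit Types (V W X : normedModType R).

Lemma C_on_sub V W r (U U' : set V) (f : V -> W) :
  U' `<=` U -> C_on r U f -> C_on r U' f.
Proof.
move=> UU; elim: r f => [|r IH] f /=; first by move=> H x /UU /H.
by case=> df Hf; split => [x /UU /df//|v]; exact: IH.
Qed.

(** [C_on] is a conjunction of conditions at the single points of [U], so sets [U'] that vary with
    the point can be patched. *)
Lemma C_on_local V W r (U : set V) (f : V -> W) :
  (forall x, U x -> exists2 U', U' x & C_on r U' f) -> C_on r U f.
Proof.
elim: r f => [|r IH] f /= H.
  by move=> x /H[U' U'x]; exact.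
split=> [x /H[U' U'x] [+ _]|v]; first exact.
by apply: IH => x /H[U' U'x [_ ?]]; exists U'.
Qed.

Lemma C_onS V W r (U : set V) (f : V -> W) : C_on r.+1 U f -> C_on r U f.
Proof.
elim: r f => [|r IH] f /=.
  by case=> df _ x /df; exact: differentiable_continuous.
by case=> df H; split => // v; apply: IH; split; [have [] := H v|have [] := H v].
Qed.

(** On an open set equality passes to all directional derivatives. In the inductions below this
    replaces ['D_v f] by the formula of a differentiation rule that is valid on [U] only. *)
Lemma C_on_eq V W r (U : set V) (f g : V -> W) : open U ->
  (forall x, U x -> f x = g x) -> C_on r U f -> C_on r U g.
Proof.
move=> oU; elim: r f g => [|r IH] f g fg /=.
  move=> cf x Ux; have cfx : f @ x --> f x by exact: cf.
  rewrite (fg x Ux) in cfx.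
  apply: cvg_trans cfx; apply: near_eq_cvg.
  by have := open_nbhs_nbhs (conj oU Ux); apply: filterS => y /fg.
have nfg x : U x -> {near x, f =1 g}.
  by move=> Ux; have := open_nbhs_nbhs (conj oU Ux); apply: filterS => y /fg.
case=> df Hf; split=> [x Ux|v].
  by apply: near_eq_differentiable (df x Ux); exact: nfg.
by apply: IH (Hf v) => x Ux; exact: near_eq_derive (nfg _ Ux).
Qed.

Lemma C_on_cst V W r (U : set V) (w : W) : C_on r U (fun _ : V => w).
Proof.
elim: r w => [|r IH] w /=; first by move=> x _; exact: cvg_cst.
split => [x _|v]; first exact: differentiable_cst.
have -> : 'D_v (fun=> w) = (fun=> 0) :> (V -> W).
  by apply/funext => x; rewrite derive_cst.
exact: IH.
Qed.

Lemma C_on_linear V W r (U : set V) (f : V -> W) :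
  linear f -> continuous f -> C_on r U f.
Proof.
move=> lf cf; case: r => [|r] /=; first by move=> x _; exact: cf.
split => [x _|v]; first by have [] := linear_derive x 0 lf cf.
rewrite (_ : (fun _ => _) = fun=> f v); first exact: C_on_cst.
by apply/funext => x; have [] := linear_derive x v lf cf.
Qed.

Lemma C_onD V W r (U : set V) (f g : V -> W) : open U ->
  C_on r U f -> C_on r U g -> C_on r U (fun x => f x + g x).
Proof.
move=> oU; elim: r f g => [|r IH] f g /=.
  by move=> cf cg x Ux; apply: cvgD; [exact: cf|exact: cg].
move=> [df Hf] [dg Hg]; split=> [x Ux|v].
  by apply: differentiableD; [exact: df|exact: dg].
apply: C_on_eq (IH _ _ (Hf v) (Hg v)) => // x Ux.
by rewrite [RHS]deriveD //; apply: diff_derivable; [exact: df|exact: dg].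
Qed.

Lemma C_on_linear_post V W X r (U : set V) (f : V -> W) (L : W -> X) :
  open U -> linear L -> continuous L -> C_on r U f -> C_on r U (L \o f).
Proof.
move=> oU lL cL; elim: r f => [|r IH] f /=.
  by move=> cf x Ux; apply: continuous_comp; [exact: cf|exact: cL].
case=> df Hf; split=> [x Ux|v].
  by have [] := differentiable_linear 0 lL cL (df _ Ux).
apply: C_on_eq (IH _ (Hf v)) => // x Ux /=.
by have [_ ->] := differentiable_linear v lL cL (df _ Ux).
Qed.

(** The chain rule turns [v] into the constant direction [L v], so the induction goes through
    without a basis of [W], in particular for product spaces such as that of the jet coordinates. *)
Lemma C_on_linear_pre V W X r (U : set W) (L : V -> W) (f : W -> X) :
  open U -> linear L -> continuous L -> C_on r U f ->
  C_on r (L @^-1` U) (f \o L).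
Proof.
move=> oU lL cL.
have oV : open (L @^-1` U) by apply: open_comp => // x _; exact: cL.
elim: r f => [|r IH] f /=.
  by move=> cf x Ux; apply: continuous_comp; [exact: cL|exact: cf].
case=> df Hf; split=> [x Ux|v].
  apply: differentiable_comp; last exact: df.
  by have [] := linear_derive x 0 lL cL.
apply: C_on_eq (IH _ (Hf (L v))) => // x Ux /=.
have [dL <-] := linear_derive x v lL cL.
by rewrite -derive_comp //; exact: df.
Qed.

(** The Leibniz rule pairs the derivative of one factor with the other factor itself, whose order
    must first be lowered by [C_onS]. *)
Lemma C_on_scale V W r (U : set V) (a : V -> R) (f : V -> W) : open U ->
  C_on r U a -> C_on r U f -> C_on r U (fun x => a x *: f x).
Proof.
move=> oU; elim: r a f => [|r IH] a f.
  by move=> /= ca cf x Ux; apply: cvgZ; [exact: ca|exact: cf].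
move=> Ha Hf; have Ha' := C_onS Ha; have Hf' := C_onS Hf.
case: Ha Hf => [da Ha] [df Hf]; split=> [x Ux|v].
  by apply: differentiable_scale; [exact: da|exact: df].
have H := C_onD oU (IH _ _ (Ha v) Hf') (IH _ _ Ha' (Hf v)).
apply: C_on_eq H => // x Ux.
by rewrite derive_scale //; [exact: da|exact: df].
Qed.

Lemma C_on_sum V W r (U : set V) (I : finType) (f : I -> V -> W) : open U ->
  (forall i, C_on r U (f i)) -> C_on r U (fun x => \sum_i f i x).
Proof.
move=> oU Hf.
suff H (s : seq I) : C_on r U (fun x => \sum_(i <- s) f i x) by exact: H.
elim: s => [|i s IH].
  by under eq_fun do rewrite big_nil; exact: C_on_cst.
by under eq_fun do rewrite big_cons; exact: C_onD.
Qed.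

Lemma coord_linear m n i j : linear (fun A : 'M[R]_(m, n) => A i j : R).
Proof. by move=> a A B; rewrite !mxE. Qed.

(** The chain rule differentiates [g] in the direction ['D_v f x], which varies with [x]. Expanding
    it in the basis of the intermediate row space leaves products of a coordinate of ['D_v f] with a
    derivative of [g] in a fixed direction, within reach of the induction and of [C_on_scale]. *)
Lemma C_on_comp V n X r (U : set V) (U' : set 'rV[R]_n) (f : V -> 'rV[R]_n)
    (g : 'rV[R]_n -> X) : open U -> open U' -> f @` U `<=` U' ->
  C_on r U f -> C_on r U' g -> C_on r U (g \o f).
Proof.
move=> oU oU' fU; elim: r f g fU => [|r IH] f g fU.
  move=> /= cf cg x Ux; apply: continuous_comp; first exact: cf.
  by apply: cg; apply: fU; exists x.
move=> Hf; have Hf' := C_onS Hf; case: Hf => df Hf [dg Hg].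
split=> [x Ux|v].
  by apply: differentiable_comp; [exact: df|apply: dg; apply: fU; exists x].
pose F i x := ('D_v f x) 0 i *: 'D_(delta_mx 0 i) g (f x).
have H : C_on r U (fun x => \sum_i F i x).
  apply: C_on_sum => // i; apply: C_on_scale => //; last first.
    exact: (IH f ('D_(delta_mx 0 i) g) fU Hf' (Hg _)).
  apply: (C_on_linear_post oU (coord_linear 0 i)) (Hf v).
  exact: coord_continuous.
apply: C_on_eq H => // x Ux.
have dgx : differentiable g (f x) by apply: dg; apply: fU; exists x.
by rewrite derive_comp ?(derive_delta _ dgx) //; exact: df.
Qed.

End C_on.

(** * Germs of smooth functions *)

Section smooth_near.
Context {R : realType}.
Implicit Types (V W X : normedModType R).

Definition smooth_near V W (f : V -> W) (x : V) :=
  exists U, [/\ open U, U x & smooth_on U f].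

Lemma smooth_on_near V W (U : set V) (f : V -> W) x :
  open U -> U x -> smooth_on U f -> smooth_near f x.
Proof. by exists U. Qed.

Lemma smooth_near_on V W (U : set V) (f : V -> W) :
  (forall x, U x -> smooth_near f x) -> smooth_on U f.
Proof.
by move=> H r; apply: C_on_local => x /H[U' [_ U'x /(_ r)]]; exists U'.
Qed.

Lemma smooth_near_nbhs V W (f : V -> W) x :
  smooth_near f x -> \forall y \near x, smooth_near f y.
Proof.
case=> U [oU Ux sf]; have := open_nbhs_nbhs (conj oU Ux).
by apply: filterS => y Uy; exists U.
Qed.

Lemma smooth_near_eq V W (f g : V -> W) x :
  {near x, f =1 g} -> smooth_near f x -> smooth_near g x.
Proof.
move=> fg [U [oU Ux sf]].
have [U' [oU' U'x] {}fg] : exists2 U', open_nbhs x U' & U' `<=` (fun y => f y = g y).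
  by move: fg; rewrite /prop_near1 nbhsE.
exists (U `&` U'); split => //; first exact: openI.
move=> r; apply: (C_on_eq (f := f)); first exact: openI.
  by move=> y [_ /fg].
by apply: C_on_sub (sf r) => y [].
Qed.

Lemma smooth_near_differentiable V W (f : V -> W) x :
  smooth_near f x -> differentiable f x.
Proof. by case=> U [_ Ux /(_ 1)[df _]]; exact: df. Qed.

Lemma smooth_near_continuous V W (f : V -> W) x :
  smooth_near f x -> {for x, continuous f}.
Proof. by case=> U [_ Ux /(_ 0)]; exact. Qed.

Lemma smooth_near_derive V W (f : V -> W) x v :
  smooth_near f x -> smooth_near ('D_v f) x.
Proof.
by case=> U [oU Ux sf]; exists U; split => // r; have [_ H] := sf r.+1; exact: H.
Qed.

Lemma smooth_near_cst V W (w : W) (x : V) : smooth_near (fun _ => w) x.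
Proof. by exists setT; split; [exact: openT| |move=> r; exact: C_on_cst]. Qed.

Lemma smooth_near_linear V W (f : V -> W) x :
  linear f -> continuous f -> smooth_near f x.
Proof.
by exists setT; split; [exact: openT| |move=> r; exact: C_on_linear].
Qed.

Lemma smooth_near2 V W W' (f : V -> W) (g : V -> W') x :
  smooth_near f x -> smooth_near g x ->
  exists U, [/\ open U, U x, smooth_on U f & smooth_on U g].
Proof.
move=> [U [oU Ux sf]] [U' [oU' U'x sg]]; exists (U `&` U'); split => //.
- exact: openI.
- by move=> r; apply: C_on_sub (sf r) => y [].
- by move=> r; apply: C_on_sub (sg r) => y [].
Qed.

Lemma smooth_nearD V W (f g : V -> W) x :
  smooth_near f x -> smooth_near g x -> smooth_near (fun y => f y + g y) x.
Proof.
move=> sf sg; have [U [oU Ux {}sf {}sg]] := smooth_near2 sf sg.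
by exists U; split => // r; exact: C_onD.
Qed.

Lemma smooth_near_scale V W (a : V -> R) (f : V -> W) x :
  smooth_near a x -> smooth_near f x -> smooth_near (fun y => a y *: f y) x.
Proof.
move=> sf sg; have [U [oU Ux {}sf {}sg]] := smooth_near2 sf sg.
by exists U; split => // r; exact: C_on_scale.
Qed.

Lemma smooth_near_sum V W (I : finType) (f : I -> V -> W) x :
  (forall i, smooth_near (f i) x) -> smooth_near (fun y => \sum_i f i y) x.
Proof.
move=> Hf; suff H (s : seq I) : smooth_near (fun y => \sum_(i <- s) f i y) x.
  exact: H.
elim: s => [|i s IH].
  by under eq_fun do rewrite big_nil; exact: smooth_near_cst.
by under eq_fun do rewrite big_cons; exact: smooth_nearD.
Qed.

Lemma smooth_near_linear_post V W X (f : V -> W) (L : W -> X) x :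
  linear L -> continuous L -> smooth_near f x -> smooth_near (L \o f) x.
Proof.
move=> lL cL [U [oU Ux sf]]; exists U; split => // r.
exact: C_on_linear_post.
Qed.

Lemma smooth_near_linear_pre V W X (L : V -> W) (f : W -> X) x :
  linear L -> continuous L -> smooth_near f (L x) -> smooth_near (f \o L) x.
Proof.
move=> lL cL [U [oU Ux sf]]; exists (L @^-1` U); split => //.
  by apply: open_comp => // y _; exact: cL.
by move=> r; exact: C_on_linear_pre.
Qed.

Lemma smooth_near_comp V n X (f : V -> 'rV[R]_n) (g : 'rV[R]_n -> X) x :
  smooth_near f x -> smooth_near g (f x) -> smooth_near (g \o f) x.
Proof.
move=> [U [oU Ux sf]] [U' [oU' U'x sg]].
(* [f] is known to be continuous on [U] only, so openness is checked point by point. *)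
have oUU : open (U `&` f @^-1` U').
  rewrite openE => y [Uy U'y]; apply: filterI.
    exact: open_nbhs_nbhs.
  by apply: (sf 0 y Uy); apply: open_nbhs_nbhs.
exists (U `&` f @^-1` U'); split => // r.
apply: (C_on_comp oUU oU'); last exact: sg.
  by move=> _ [y [_ ?] <-].
by apply: C_on_sub (sf r) => y [].
Qed.

Lemma smooth_near_coord V m n (f : V -> 'M[R]_(m, n)) x i j :
  smooth_near f x -> smooth_near (fun y => f y i j) x.
Proof.
move=> sf; apply: (smooth_near_linear_post (coord_linear i j)) sf.
exact: coord_continuous.
Qed.

Lemma smooth_near_mx V m n (f : V -> 'M[R]_(m, n)) x :
  (forall i j, smooth_near (fun y => f y i j) x) -> smooth_near f x.
Proof.
move=> sf; rewrite (_ : f = fun y => \sum_i \sum_j f y i j *: delta_mx i j).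
  apply: smooth_near_sum => i; apply: smooth_near_sum => j.
  by apply: smooth_near_scale => //; exact: smooth_near_cst.
by apply/funext => y; rewrite -matrix_sum_delta.
Qed.

Lemma smooth_near_row_mx V m n1 n2 (f : V -> 'M[R]_(m, n1))
    (g : V -> 'M[R]_(m, n2)) x :
  smooth_near f x -> smooth_near g x -> smooth_near (fun y => row_mx (f y) (g y)) x.
Proof.
move=> sf sg; apply: smooth_near_mx => i j.
under eq_fun do rewrite mxE; case: split_ordP => k _; exact: smooth_near_coord.
Qed.

Lemma smooth_near_mulmx V m n p (f : V -> 'M[R]_(m, n)) (g : V -> 'M[R]_(n, p)) x :
  smooth_near f x -> smooth_near g x -> smooth_near (fun y => f y *m g y) x.
Proof.
move=> sf sg; apply: smooth_near_mx => i j.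
under eq_fun do rewrite mxE; apply: smooth_near_sum => k.
by apply: smooth_near_scale; exact: smooth_near_coord.
Qed.

(** The basis expansion leaves smooth coefficients times derivatives in fixed directions. It rests
    on differentiability of [f], hence is available near [x] only. *)
Lemma smooth_near_dir_derive n W (f : 'rV[R]_n -> W) (X : 'rV[R]_n -> 'rV[R]_n) x :
  smooth_near f x -> smooth_near X x -> smooth_near (fun y => 'D_(X y) f y) x.
Proof.
move=> sf sX.
apply: (@smooth_near_eq _ _ (fun y => \sum_i X y 0 i *: 'D_(delta_mx 0 i) f y)).
  apply: filterS (smooth_near_nbhs sf) => y sy.
  by rewrite [RHS]derive_delta //; exact: smooth_near_differentiable.
apply: smooth_near_sum => i; apply: smooth_near_scale.
  exact: smooth_near_coord.
exact: smooth_near_derive.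
Qed.

Lemma derive_coord V m n (f : V -> 'M[R]_(m, n)) x v i j : differentiable f x ->
  'D_v (fun y => f y i j) x = ('D_v f x) i j.
Proof.
move=> df; have [] := differentiable_linear v (coord_linear i j) _ df => //.
exact: coord_continuous.
Qed.

Lemma derive_comm V m n (f : V -> 'M[R]_(m, n)) x v w :
  smooth_near f x -> 'D_w ('D_v f) x = 'D_v ('D_w f) x.
Proof.
move=> sf; apply/matrixP => i j.
have fij : smooth_near (fun y => f y i j) x by exact: smooth_near_coord.
have E u u' : ('D_u ('D_u' f) x) i j = 'D_u ('D_u' (fun y => f y i j)) x.
  have du : smooth_near ('D_u' f) x by exact: smooth_near_derive.
  rewrite -derive_coord; last exact: smooth_near_differentiable.
  apply: near_eq_derive; apply: filterS (smooth_near_nbhs sf) => y sy.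
  by rewrite derive_coord //; exact: smooth_near_differentiable.
apply: (etrans (E w v)); apply: (etrans _ (esym (E v w))).
apply: derive_comm_real.
- apply: filterS (smooth_near_nbhs fij) => y fy.
  split; apply: diff_derivable; apply: smooth_near_differentiable.
  + exact: fy.
  + exact: fy.
  + exact: smooth_near_derive.
  + exact: smooth_near_derive.
- by apply: smooth_near_continuous; do 2 apply: smooth_near_derive.
- by apply: smooth_near_continuous; do 2 apply: smooth_near_derive.
Qed.

(** Expand the direction in the basis and apply the product rule. The same expansion [E] for the
    constant field [fun=> X x] isolates the terms whose coefficients are not differentiated. *)
Lemma derive_dir_derive n W (f : 'rV[R]_n -> W) (X : 'rV[R]_n -> 'rV[R]_n) x v :
  smooth_near f x -> differentiable X x ->
  'D_v (fun z => 'D_(X z) f z) x = 'D_v ('D_(X x) f) x + 'D_('D_v X x) f x.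
Proof.
move=> sf dX.
pose F (Y : 'rV[R]_n -> 'rV[R]_n) i y := Y y 0 i *: 'D_(delta_mx 0 i) f y.
have E (Y : 'rV[R]_n -> 'rV[R]_n) : differentiable Y x ->
    'D_v (fun z => 'D_(Y z) f z) x =
    \sum_i (('D_v Y x) 0 i *: 'D_(delta_mx 0 i) f x +
            Y x 0 i *: 'D_v ('D_(delta_mx 0 i) f) x).
  move=> dY.
  have dYi i : differentiable (fun y => Y y 0 i) x.
    have cc := @coord_continuous R 1 n 0 i.
    by have [] := differentiable_linear v (coord_linear 0 i) cc dY.
  have dfi i : differentiable ('D_(delta_mx 0 i) f) x.
    exact/smooth_near_differentiable/smooth_near_derive.
  rewrite (@near_eq_derive _ _ _ _ (\sum_i F Y i)); last first.
    apply: filterS (smooth_near_nbhs sf) => y sy; rewrite fct_sumE.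
    by apply: derive_delta; exact: smooth_near_differentiable.
  rewrite derive_sum; last first.
    by move=> i; apply/diff_derivable/differentiable_scale.
  by apply: eq_bigr => i _; rewrite /F derive_scale // derive_coord.
rewrite E // (E (fun=> X x)); last exact: differentiable_cst.
rewrite (derive_delta ('D_v X x) (smooth_near_differentiable sf)) -big_split /=.
apply: eq_bigr => i _.
by rewrite derive_cst mxE scale0r add0r addrC.
Qed.

End smooth_near.

(** * The Lie bracket and the Jacobi identity in coordinates *)

Section euclidean_bracket.
Context {R : realType}.

Definition ebracket n (X Y : 'rV[R]_n -> 'rV[R]_n) (x : 'rV[R]_n) :=
  'D_(X x) Y x - 'D_(Y x) X x.

Lemma ebracket_linear n (a : R) (X Y Z : 'rV[R]_n -> 'rV[R]_n) x :
  differentiable X x -> differentiable Y x -> differentiable Z x ->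
  ebracket (a *: X + Y) Z x = a *: ebracket X Z x + ebracket Y Z x.
Proof.
move=> dX dY dZ.
have dX' v : derivable X x v by exact: diff_derivable.
have dY' v : derivable Y x v by exact: diff_derivable.
have DE v : 'D_v (a *: X + Y) x = a *: 'D_v X x + 'D_v Y x.
  apply: (etrans (deriveD (@derivableZ _ _ _ _ a _ _ (dX' v)) (dY' v))).
  exact: (congr1 (fun u => u + _) (@deriveZ _ _ _ _ a _ _ (dX' v))).
have DZ : 'D_((a *: X + Y) x) Z x = a *: 'D_(X x) Z x + 'D_(Y x) Z x.
  by rewrite !(deriveE _ dZ) linearP.
apply: (etrans (congr2 (fun u v => u - v) DZ (DE (Z x)))).
have distr (t u v w : 'rV[R]_n) :
    a *: t + u - (a *: v + w) = a *: (t - v) + (u - w).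
  by rewrite scalerBr opprD addrACA.
exact: distr.
Qed.

(** Differentiating [T' (f z) = 'd f z (T z)] along [Z] gives a second derivative of [f] in the
    directions [Z x] and [T x], plus the image under ['d f x] of ['D_(Z x) T x]. The first part is
    symmetric and drops out of the difference. *)
Lemma ebracket_related n p (f : 'rV[R]_n -> 'rV[R]_p)
    (X Y : 'rV[R]_n -> 'rV[R]_n) (X' Y' : 'rV[R]_p -> 'rV[R]_p) x :
  smooth_near f x -> differentiable X x -> differentiable Y x ->
  differentiable X' (f x) -> differentiable Y' (f x) ->
  (\forall z \near x, X' (f z) = 'd f z (X z)) ->
  (\forall z \near x, Y' (f z) = 'd f z (Y z)) ->
  ebracket X' Y' (f x) = 'd f x (ebracket X Y x).
Proof.
move=> sf dX dY dX' dY' fX fY.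
have df := smooth_near_differentiable sf.
have half (Z T : 'rV[R]_n -> 'rV[R]_n) (Z' T' : 'rV[R]_p -> 'rV[R]_p) :
    differentiable Z x -> differentiable T x -> differentiable T' (f x) ->
    (\forall z \near x, Z' (f z) = 'd f z (Z z)) ->
    (\forall z \near x, T' (f z) = 'd f z (T z)) ->
    'D_(Z' (f x)) T' (f x) = 'D_(Z x) ('D_(T x) f) x + 'd f x ('D_(Z x) T x).
  move=> dZ dT dT' fZ fT.
  rewrite (nbhs_singleton fZ) -(deriveE _ df) -derive_comp //.
  rewrite -[in RHS](deriveE _ df) -derive_dir_derive //.
  apply: near_eq_derive; apply: filterS2 fT (smooth_near_nbhs sf) => z /= -> sz.
  by rewrite deriveE //; exact: smooth_near_differentiable.
rewrite /ebracket (half X Y) // (half Y X) // linearB /=.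
have cancel (a a' b c : 'rV[R]_p) : a = a' -> a + b - (a' + c) = b - c.
  by move=> ->; rewrite opprD addrACA subrr add0r.
exact: (cancel _ _ _ _ (derive_comm (Y x) (X x) sf)).
Qed.

Lemma ebracket_jacobi n (X Y Z : 'rV[R]_n -> 'rV[R]_n) x :
  smooth_near X x -> smooth_near Y x -> smooth_near Z x ->
  ebracket X (ebracket Y Z) x + ebracket Y (ebracket Z X) x
  + ebracket Z (ebracket X Y) x = 0.
Proof.
have E (T U W : 'rV[R]_n -> 'rV[R]_n) :
    smooth_near T x -> smooth_near U x -> smooth_near W x ->
    ebracket T (ebracket U W) x =
      'D_(T x) ('D_(U x) W) x - 'D_(T x) ('D_(W x) U) x
      + ('D_('D_(T x) U x) W x - 'D_('D_(T x) W x) U x)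
      - ('D_('D_(U x) W x) T x - 'D_('D_(W x) U x) T x).
  move=> sT sU sW.
  have dT := smooth_near_differentiable sT.
  have dW := smooth_near_differentiable sW.
  have dU := smooth_near_differentiable sU.
  have dUW := smooth_near_differentiable (smooth_near_dir_derive sW sU).
  have dWU := smooth_near_differentiable (smooth_near_dir_derive sU sW).
  rewrite {1}/ebracket; congr (_ - _).
    apply: (etrans (deriveB (@diff_derivable _ _ _ _ _ _ dUW)
                            (@diff_derivable _ _ _ _ _ _ dWU))).
    apply: (etrans (congr2 (fun a b => a - b) (derive_dir_derive (T x) sW dU)
                                              (derive_dir_derive (T x) sU dW))).
    by rewrite opprD addrACA.
  by rewrite !(deriveE _ dT) /ebracket linearB.
(* Over the cyclic sum the second derivatives pair off by symmetry as [a], [b], [c], and each of the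
   six derivatives along a derivative, [d1] to [d6], occurs once with either sign. *)
have cancel (a a' b b' c c' d1 d2 d3 d4 d5 d6 : 'rV[R]_n) :
    a = a' -> b = b' -> c = c' ->
    (a - b + (d1 - d2) - (d3 - d4)) + (c - a' + (d3 - d5) - (d6 - d2))
      + (b' - c' + (d6 - d4) - (d1 - d5)) = 0.
  by move=> -> -> ->; apply/rowP => i; rewrite !mxE; ring.
move=> sX sY sZ; rewrite !E //.
apply: cancel; exact: derive_comm.
Qed.

End euclidean_bracket.

(** * Charts and vector fields *)

Section charts.
Context {R : realType} {n : nat} {M : manifold R n}.
Implicit Types (c : chart R n M) (p : M).

Lemma atlas_is_chart c : atlas c -> is_chart c.
Proof. by case: M c => T A h1 h2 h3 h4 h5 h6 c; exact: h3. Qed.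

Lemma atlas_cover p : exists c, chart_at p c.
Proof.
by case: M p => T A h1 h2 h3 h4 h5 h6 p; have [c ? ?] := h4 p; exists c.
Qed.

Lemma atlas_compatible c c' : atlas c -> atlas c' -> compatible c c'.
Proof. by case: M c c' => T A h1 h2 h3 h4 h5 h6 c c'; exact: h5. Qed.

Lemma atlas_maximal c : is_chart c ->
  (forall c', atlas c' -> compatible c c') -> atlas c.
Proof. by case: M c => T A h1 h2 h3 h4 h5 h6 c; exact: h6. Qed.

Lemma chartK p c : chart_at p c -> cinv c (cmap c p) = p.
Proof. by case=> /atlas_is_chart[_ _ K _ _]; exact: K. Qed.

Lemma chart_dom_nbhs p c : chart_at p c -> \forall q \near p, chart_at q c.
Proof.
case=> ac cp; have [oc _ _ _ _] := atlas_is_chart ac.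
by apply: filterS (open_nbhs_nbhs (conj oc cp)) => q ?; split.
Qed.

Lemma cmap_continuous p c : chart_at p c -> {for p, continuous (cmap c)}.
Proof. by case=> /atlas_is_chart[_ _ _ K _]; exact: K. Qed.

Lemma cinv_continuous p c : chart_at p c -> {for cmap c p, continuous (cinv c)}.
Proof. by case=> /atlas_is_chart[_ _ _ _ K]; exact: K. Qed.

Lemma cinv_near p c (P : set M) : chart_at p c ->
  (\forall q \near p, P q) -> \forall y \near cmap c p, P (cinv c y).
Proof.
move=> cp Pp; have cc : cinv c @ cmap c p --> cinv c (cmap c p).
  exact: cinv_continuous.
by apply: cc; rewrite chartK.
Qed.

Lemma chart_near p c : chart_at p c ->
  \forall y \near cmap c p, chart_at (cinv c y) c /\ cmap c (cinv c y) = y.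
Proof.
move=> [ac cp]; have [_ oi K _ _] := atlas_is_chart ac.
have : nbhs (cmap c p) (cmap c @` cdom c).
  by apply: open_nbhs_nbhs; split => //; exists p.
by apply: filterS => _ [q cq <-]; rewrite K.
Qed.

(** A chart has an open image by definition; for a smaller open set the continuity of [cinv c] keeps
    nearby preimages inside [A]. *)
Lemma chart_image_open c (A : set M) : atlas c -> open A ->
  open (cmap c @` (cdom c `&` A)).
Proof.
move=> ac oA; rewrite openE => _ [p [cp Ap] <-].
have Ap' : \forall q \near p, A q by apply: open_nbhs_nbhs.
have cpc : chart_at p c by [].
apply: filterS2 (chart_near cpc) (cinv_near cpc Ap') => y [[_ cy] yK] Ay.
by exists (cinv c y).
Qed.

End charts.

Section smooth_maps.
Context {R : realType}.

(** [local_rep c c' id] is the transition map, so this is compatibility of the atlas. Changes of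
    charts become instances of the lemmas on smooth maps. *)
Lemma smooth_at_id n (M : manifold R n) (p : M) : smooth_at (@id M) p.
Proof.
split=> [|c c' [ac cp] [ac' cp']]; first exact: cvg_id.
have [oc' _ _ _ _] := atlas_is_chart ac'.
have [sf _] := atlas_compatible ac ac'.
exists (cmap c @` (cdom c `&` cdom c')); split => //.
  exact: chart_image_open.
by exists p.
Qed.

Section local_rep.
Context {m n : nat} {M : manifold R m} {N : manifold R n}.
Implicit Types (f : M -> N) (p : M).

Lemma local_rep_smooth f p c c' : smooth_at f p ->
  chart_at p c -> chart_at (f p) c' -> smooth_near (local_rep c c' f) (cmap c p).
Proof. by case=> _; exact. Qed.

Lemma local_repE f p c c' : chart_at p c -> local_rep c c' f (cmap c p) = cmap c' (f p).
Proof. by move=> cp; rewrite /local_rep chartK. Qed.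

Lemma local_rep_near f p c (c' : chart R n N) : {for p, continuous f} ->
  chart_at p c -> chart_at (f p) c' ->
  \forall y \near cmap c p, [/\ chart_at (cinv c y) c, cmap c (cinv c y) = y
    & chart_at (f (cinv c y)) c'].
Proof.
move=> cf cp cp'.
have fc' : \forall q \near p, chart_at (f q) c' by exact: (cf _ (chart_dom_nbhs cp')).
by apply: filterS2 (chart_near cp) (cinv_near cp fc') => y [].
Qed.

End local_rep.

Section comp.
Context {m n l : nat} {M : manifold R m} {N : manifold R n} {P : manifold R l}.
Implicit Types (f : M -> N) (g : N -> P) (p : M).

Lemma local_rep_comp f g p c c' (c'' : chart R l P) : {for p, continuous f} ->
  chart_at p c -> chart_at (f p) c' ->
  {near cmap c p,
    local_rep c' c'' g \o local_rep c c' f =1 local_rep c c'' (g \o f)}.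
Proof.
move=> cf cp cp'; apply: filterS (local_rep_near cf cp cp') => y [_ _ cy].
by rewrite /= /local_rep chartK.
Qed.

(** With [f] or [g] the identity, this is the effect of a change of charts on a differential. *)
Lemma diff_local_rep_comp f g p c c' c'' v : smooth_at f p -> smooth_at g (f p) ->
  chart_at p c -> chart_at (f p) c' -> chart_at (g (f p)) c'' ->
  'd (local_rep c c'' (g \o f)) (cmap c p) v =
  'd (local_rep c' c'' g) (cmap c' (f p)) ('d (local_rep c c' f) (cmap c p) v).
Proof.
move=> sf sg cp cp' cp''.
have df := smooth_near_differentiable (local_rep_smooth sf cp cp').
have := smooth_near_differentiable (local_rep_smooth sg cp' cp'').
rewrite -(local_repE f c' cp) => dg.
rewrite (near_eq_diff (differentiable_comp df dg)); last first.
  by apply: local_rep_comp => //; case: sf.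
by rewrite (diff_comp df dg).
Qed.

End comp.
End smooth_maps.

(** * Vector fields on manifolds and their Lie algebra *)

Section vector_fields.
Context {R : realType}.

Definition vrep n (M : manifold R n) (X : M -> tvec R n M) (c : chart R n M) :=
  fun y : 'rV[R]_n => X (cinv c y) c.

Lemma vrepE n (M : manifold R n) (X : M -> tvec R n M) p c :
  chart_at p c -> vrep X c (cmap c p) = X p c.
Proof. by move=> cp; rewrite /vrep chartK. Qed.

Lemma vfield_smooth n (M : manifold R n) (X : M -> tvec R n M) p c :
  vfield X -> chart_at p c -> smooth_near (vrep X c) (cmap c p).
Proof.
case=> _ sX [ac cp]; have [_ oi _ _ _] := atlas_is_chart ac.
by apply: smooth_on_near oi _ (sX c ac); exists p.
Qed.

Lemma vfield_out n (M : manifold R n) (X : M -> tvec R n M) p c :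
  vfield X -> ~ chart_at p c -> X p c = 0.
Proof. by case=> tX _; have [+ _] := tX p; exact. Qed.

(* The transformation law of tangent vectors is relatedness to the identity, so
   that facts on related fields also give independence of the chart. *)
Lemma vfield_related_id n (M : manifold R n) (X : M -> tvec R n M) :
  vfield X -> related id X X.
Proof. by case=> tX _ p c c' cp cp'; have [_] := tX p; exact. Qed.

Lemma vfieldP n (M : manifold R n) (X : M -> tvec R n M) :
  (forall p c, ~ chart_at p c -> X p c = 0) -> related id X X ->
  (forall p c, chart_at p c -> smooth_near (vrep X c) (cmap c p)) -> vfield X.
Proof.
move=> X0 rX sX; split=> [p|c ac].
  by split=> [c|c c' cp cp']; [exact: X0|exact: rX].
by apply: smooth_near_on => _ [p cp <-]; exact: sX.
Qed.

Lemma near_eq_ebracket n (X X' Y Y' : 'rV[R]_n -> 'rV[R]_n) x :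
  {near x, X =1 X'} -> {near x, Y =1 Y'} -> ebracket X Y x = ebracket X' Y' x.
Proof.
move=> XX YY; rewrite /ebracket (nbhs_singleton XX) (nbhs_singleton YY).
exact: (congr2 (fun a b => a - b) (near_eq_derive _ YY) (near_eq_derive _ XX)).
Qed.

Lemma lie_bracketE n (M : manifold R n) (X Y : M -> tvec R n M) p c :
  chart_at p c -> lie_bracket X Y p c = ebracket (vrep X c) (vrep Y c) (cmap c p).
Proof.
move=> cp; rewrite /ebracket (vrepE X cp) (vrepE Y cp) /lie_bracket.
by rewrite (asboolT cp).
Qed.

Lemma vrep_bracket n (M : manifold R n) (X Y : M -> tvec R n M) p c :
  chart_at p c -> {near cmap c p,
    ebracket (vrep X c) (vrep Y c) =1 vrep (lie_bracket X Y) c}.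
Proof.
move=> cp; apply: filterS (chart_near cp) => y [cy yK].
by apply: (etrans _ (esym (lie_bracketE X Y cy))); rewrite yK.
Qed.

(** Serves twice: for [f = id] it is the transformation law of the bracket under changes of charts,
    for [f = pi] it makes [pi_*] compatible with brackets. *)
Lemma related_bracket m n (M : manifold R m) (N : manifold R n) (f : M -> N)
    (X Y : M -> tvec R m M) (X' Y' : N -> tvec R n N) :
  (forall p, smooth_at f p) -> vfield X -> vfield Y -> vfield X' -> vfield Y' ->
  related f X X' -> related f Y Y' ->
  related f (lie_bracket X Y) (lie_bracket X' Y').
Proof.
move=> sf vX vY vX' vY' fX fY p c c' cp cp'.
rewrite (lie_bracketE X Y cp) (lie_bracketE X' Y' cp') -(local_repE f c' cp).
have cf : {for p, continuous f} by case: (sf p).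
have frep (Z : M -> tvec R m M) (Z' : N -> tvec R n N) : related f Z Z' ->
    \forall z \near cmap c p,
      vrep Z' c' (local_rep c c' f z) = 'd (local_rep c c' f) z (vrep Z c z).
  move=> fZ; apply: filterS (local_rep_near cf cp cp') => z [cz zK cz'].
  apply: (etrans (vrepE Z' cz')); apply: (etrans (fZ _ _ _ cz cz')).
  by rewrite zK.
have dv k (L : manifold R k) (Z : L -> tvec R k L) q d : vfield Z ->
    chart_at q d -> differentiable (vrep Z d) (cmap d q).
  by move=> vZ dq; exact/smooth_near_differentiable/vfield_smooth.
apply: ebracket_related.
- exact: local_rep_smooth.
- exact: dv.
- exact: dv.
- by rewrite local_repE //; exact: dv.
- by rewrite local_repE //; exact: dv.
- exact: frep.
- exact: frep.
Qed.

Lemma vfield_bracket n (M : manifold R n) (X Y : M -> tvec R n M) :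
  vfield X -> vfield Y -> vfield (lie_bracket X Y).
Proof.
move=> vX vY; apply: vfieldP => [p c cp||p c cp].
- by rewrite /lie_bracket asboolF.
- apply: related_bracket => //; last 2 first.
  + exact: vfield_related_id.
  + exact: vfield_related_id.
  by move=> p; exact: smooth_at_id.
- apply: smooth_near_eq (vrep_bracket X Y cp) _.
  have sX := vfield_smooth vX cp; have sY := vfield_smooth vY cp.
  apply: smooth_nearD; first exact: smooth_near_dir_derive.
  have : smooth_near (fun y => (-1) *: 'D_(vrep Y c y) (vrep X c) y) (cmap c p).
    apply: smooth_near_scale; first exact: smooth_near_cst.
    exact: smooth_near_dir_derive.
  by under eq_fun do rewrite scaleN1r.
Qed.

Lemma related_linear m n (M : manifold R m) (N : manifold R n) (f : M -> N)
    (a : R) (X Y : M -> tvec R m M) (X' Y' : N -> tvec R n N) :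
  related f X X' -> related f Y Y' -> related f (a *: X + Y) (a *: X' + Y').
Proof.
move=> fX fY p c c' cp cp'.
have -> : (a *: X + Y) p c = a *: X p c + Y p c by [].
have -> : (a *: X' + Y') (f p) c' = a *: X' (f p) c' + Y' (f p) c' by [].
by rewrite linearP (fX p c c') // (fY p c c').
Qed.

Lemma related0 m n (M : manifold R m) (N : manifold R n) (f : M -> N) :
  related f (0 : M -> tvec R m M) (0 : N -> tvec R n N).
Proof.
move=> p c c' cp cp'.
have -> : (0 : M -> tvec R m M) p c = 0 by [].
by rewrite linear0.
Qed.

Lemma vfield0 n (M : manifold R n) : vfield (0 : M -> tvec R n M).
Proof.
apply: vfieldP => // [|p c cp]; first exact: related0.
exact: smooth_near_cst.
Qed.

Lemma vfield_linear n (M : manifold R n) (a : R) (X Y : M -> tvec R n M) :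
  vfield X -> vfield Y -> vfield (a *: X + Y).
Proof.
move=> vX vY; apply: vfieldP => [p c cp||p c cp].
- have -> : (a *: X + Y) p c = a *: X p c + Y p c by [].
  by rewrite !vfield_out // scaler0 addr0.
- by apply: related_linear; exact: vfield_related_id.
- apply: smooth_nearD; last exact: vfield_smooth.
  apply: smooth_near_scale; first exact: smooth_near_cst.
  exact: vfield_smooth.
Qed.

Lemma lie_bracketC n (M : manifold R n) (X Y : M -> tvec R n M) :
  lie_bracket X Y = - lie_bracket Y X.
Proof.
apply/funext => p; apply/funext => c.
transitivity (- lie_bracket Y X p c) => //.
have skew (b : bool) (u v : 'rV[R]_n) :
    (if b then u - v else 0) = - (if b then v - u else 0).
  by case: b; rewrite ?opprB ?oppr0.
exact: skew.
Qed.

Lemma vfield_lie_algebra n (M : manifold R n) :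
  lie_algebra (@vfield R n M) lie_bracket.
Proof.
split.
- by split; [exact: vfield0|exact: vfield_linear].
- exact: vfield_bracket.
- move=> a X Y Z vX vY vZ.
  have lin : lie_bracket (a *: X + Y) Z = a *: lie_bracket X Z + lie_bracket Y Z.
    apply/funext => p; apply/funext => c.
    transitivity (a *: lie_bracket X Z p c + lie_bracket Y Z p c) => //.
    have [cp|ncp] := pselect (chart_at p c); last first.
      by rewrite /lie_bracket !asboolF // scaler0 addr0.
    have dv (T : M -> tvec R n M) : vfield T -> differentiable (vrep T c) (cmap c p).
      by move=> vT; exact/smooth_near_differentiable/vfield_smooth.
    rewrite !(lie_bracketE _ _ cp).
    exact: (ebracket_linear a (dv X vX) (dv Y vY) (dv Z vZ)).
  split; first exact: lin.
  rewrite (lie_bracketC Z (a *: X + Y)) lin (lie_bracketC X Z) (lie_bracketC Y Z).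
  have opp2 (V : lmodType R) (u v : V) : - (a *: - u + - v) = a *: u + v.
    by rewrite opprD -scalerN !opprK.
  exact: opp2.
- move=> X vX; apply/funext => p; apply/funext => c.
  by rewrite /lie_bracket subrr; case: ifP.
- move=> X Y Z vX vY vZ; apply/funext => p; apply/funext => c.
  have [cp|ncp] := pselect (chart_at p c); last first.
    transitivity (lie_bracket X (lie_bracket Y Z) p c
      + lie_bracket Y (lie_bracket Z X) p c
      + lie_bracket Z (lie_bracket X Y) p c) => //.
    by rewrite /lie_bracket !asboolF // !addr0.
  (* The outer bracket differentiates the inner one, whose coordinate formula must therefore hold
     near the point and not only at it. *)
  have E (T U W : M -> tvec R n M) : lie_bracket T (lie_bracket U W) p c =
      ebracket (vrep T c) (ebracket (vrep U c) (vrep W c)) (cmap c p).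
    apply: (etrans (lie_bracketE T _ cp)).
    apply: near_eq_ebracket; first by apply: filterE.
    by apply: filterS (vrep_bracket U W cp) => y e; exact: esym e.
  transitivity (lie_bracket X (lie_bracket Y Z) p c
      + lie_bracket Y (lie_bracket Z X) p c
      + lie_bracket Z (lie_bracket X Y) p c) => //.
  apply: (etrans (congr2 +%R (congr2 +%R (E X Y Z) (E Y Z X)) (E Z X Y))).
  by apply: ebracket_jacobi; exact: vfield_smooth.
Qed.

End vector_fields.

(** * Restriction and transport of Lie algebra structures *)

Section lie_algebras.
Context {R : realType} {V W : lmodType R}.

Lemma lie_algebra_sub (S T : set V) br : lie_algebra S br -> T `<=` S ->
  T 0 -> (forall (a : R) x y, T x -> T y -> T (a *: x + y)) ->
  (forall x y, T x -> T y -> T (br x y)) -> lie_algebra T br.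
Proof.
move=> [_ _ bl alt jac] TS T0 TL Tbr; split => //.
- by move=> a x y z Tx Ty Tz; apply: bl; exact: TS.
- by move=> x Tx; apply: alt; exact: TS.
- by move=> x y z Tx Ty Tz; apply: jac; exact: TS.
Qed.

(** Elements of the image lift to [S], where the laws hold, and [f] carries them over. This gives
    the Jacobi identity for [pro_bracket] on lifts without prolonging twice. *)
Lemma lie_algebra_image (S : set V) brV brW (f : V -> W) :
  lie_algebra S brV -> lie_homomorphism S brV brW f ->
  lie_algebra (f @` S) brW.
Proof.
move=> [[S0 SL] Sbr bl alt jac] [fL fbr].
have f0 : f 0 = 0.
  have := fL 1 0 0 S0 S0; rewrite scaler0 addr0 scale1r => /eqP.
  by rewrite -subr_eq0 opprD addrA subrr add0r oppr_eq0 => /eqP.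
have fD x y : S x -> S y -> f (x + y) = f x + f y.
  by move=> Sx Sy; have := fL 1 x y Sx Sy; rewrite !scale1r.
split.
- split; first by exists 0.
  by move=> a _ _ [x Sx <-] [y Sy <-]; exists (a *: x + y); [exact: SL|exact: fL].
- by move=> _ _ [x Sx <-] [y Sy <-]; exists (brV x y); [exact: Sbr|exact: fbr].
- move=> a _ _ _ [x Sx <-] [y Sy <-] [z Sz <-].
  have [e1 e2] := bl a x y z Sx Sy Sz.
  have Sxy := SL a x y Sx Sy.
  split; rewrite -fL // -!fbr // -fL; try exact: Sbr.
    by rewrite e1.
  by rewrite e2.
- by move=> _ [x Sx <-]; rewrite -fbr // alt.
- move=> _ _ _ [x Sx <-] [y Sy <-] [z Sz <-].
  have S3 a b c : S a -> S b -> S c -> S (brV a (brV b c)).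
    by move=> Sa Sb Sc; apply: (Sbr) => //; exact: Sbr.
  have SD a b : S a -> S b -> S (a + b).
    by move=> Sa Sb; rewrite -[a]scale1r; exact: SL.
  rewrite -!fbr //; try exact: Sbr.
  rewrite -!fD //; try exact: S3; last by apply: SD; exact: S3.
  by rewrite jac.
Qed.

End lie_algebras.

(** * Jets of sections in bundle coordinates *)

Lemma derive_mulmx (R : realType) (V : normedModType R) m n p
    (f : V -> 'M[R]_(m, n)) (g : V -> 'M[R]_(n, p)) x v :
  differentiable f x -> differentiable g x -> differentiable (fun y => f y *m g y) x ->
  'D_v (fun y => f y *m g y) x = 'D_v f x *m g x + f x *m 'D_v g x.
Proof.
move=> df dg dfg; apply/matrixP => i j.
have dc q r (h : V -> 'M[R]_(q, r)) a b : differentiable h x ->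
    differentiable (fun y => h y a b) x.
  move=> dh; have [] // := differentiable_linear 0 (coord_linear a b) _ dh.
  exact: coord_continuous.
apply: (etrans (esym (derive_coord v i j dfg))).
have -> : (fun y => (f y *m g y) i j) = \sum_l (fun y => f y i l *: g y l j).
  by apply/funext => y; rewrite mxE fct_sumE.
have dl l : derivable (fun y => f y i l *: g y l j) x v.
  by apply: diff_derivable; apply: differentiable_scale; exact: dc.
apply: (etrans (derive_sum dl)).
rewrite !mxE -big_split; apply: eq_bigr => l _.
apply: (etrans (derive_scale v (dc _ _ f i l df) (dc _ _ g l j dg))).
by rewrite (derive_coord v i l df) (derive_coord v l j dg).
Qed.

Section lsubmx_rsubmx.
Context {R : realType} {m n1 n2 : nat}.

Lemma lsubmx_linear : linear (lsubmx : 'M[R]_(m, n1 + n2) -> _).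
Proof. exact: linearP. Qed.

Lemma rsubmx_linear : linear (rsubmx : 'M[R]_(m, n1 + n2) -> _).
Proof. exact: linearP. Qed.

End lsubmx_rsubmx.

Section bundle_charts.
Context {R : realType} {m k : nat} {M : manifold R m} {E : manifold R (m + k)}.
Context { pi : E -> M}.
Implicit Types (b : bchart M E) (s : lsection pi) (X Y : M -> tvec R m M).

Lemma bchart_tot b e : is_bchart pi b -> cdom (btot b) e -> chart_at e (btot b).
Proof. by case. Qed.

Lemma bchart_base b e : is_bchart pi b -> cdom (btot b) e ->
  chart_at (pi e) (bbase b).
Proof. by case=> _ ab H be; split=> //; have [] := H _ be. Qed.

Lemma bchart_lsubmx b e : is_bchart pi b -> cdom (btot b) e ->
  lsubmx (cmap (btot b) e) = cmap (bbase b) (pi e).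
Proof. by case=> _ _ H be; have [] := H _ be. Qed.

Lemma sect_foot s : pi (sect s (foot s)) = foot s.
Proof. by have [U [_ Us _ H]] := sectP s; exact: H. Qed.

Lemma sect_smooth s : smooth_at (sect s) (foot s).
Proof. by have [U [_ Us H _]] := sectP s; exact: H. Qed.

Lemma sect_near s : \forall x \near foot s, pi (sect s x) = x.
Proof.
have [U [oU Us _ H]] := sectP s.
by apply: filterS (open_nbhs_nbhs (conj oU Us)) => x /H.
Qed.

Lemma bchart_at_base b s : bchart_at b s -> chart_at (foot s) (bbase b).
Proof. by case=> bb bs; rewrite -sect_foot; exact: bchart_base. Qed.

Lemma bchart_at_tot b s : bchart_at b s -> chart_at (sect s (foot s)) (btot b).
Proof. by case=> bb bs; exact: bchart_tot. Qed.

Lemma jcoord_lsubmx b s : bchart_at b s ->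
  lsubmx (jcoord b s).1 = cmap (bbase b) (foot s).
Proof. by case=> bb bs; rewrite /= (bchart_lsubmx bb bs) sect_foot. Qed.

Lemma sect_rep_smooth b s : bchart_at b s ->
  smooth_near (local_rep (bbase b) (btot b) (sect s)) (cmap (bbase b) (foot s)).
Proof.
move=> bs; exact: (local_rep_smooth (sect_smooth s) (bchart_at_base bs)
  (bchart_at_tot bs)).
Qed.

Lemma sect_fib_smooth b s : bchart_at b s ->
  smooth_near (sect_fib b s) (cmap (bbase b) (foot s)).
Proof.
move=> bs; apply: (smooth_near_linear_post rsubmx_linear) (sect_rep_smooth bs).
exact: linear_mx_continuous rsubmx_linear.
Qed.

(** Near the foot [pi \o sect s] is the identity and the first block of the bundle coordinates is
    the base coordinates, whence [v]. The second block is the definition of [ju1], expanded in the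
    basis. *)
Lemma diff_sect b s v : bchart_at b s ->
  'd (local_rep (bbase b) (btot b) (sect s)) (cmap (bbase b) (foot s)) v =
  row_mx v (v *m ju1 b s).
Proof.
move=> bs; have cb := bchart_at_base bs; have ct := bchart_at_tot bs.
have dF := smooth_near_differentiable (sect_rep_smooth bs).
set F := local_rep _ _ _ in dF *; set y0 := cmap _ _ in dF *.
rewrite -[LHS]hsubmxK -(deriveE v dF); congr row_mx.
  have [_ <-] := differentiable_linear v lsubmx_linear
    (linear_mx_continuous lsubmx_linear) dF.
  rewrite -[RHS](derive_id y0); apply: near_eq_derive.
  have cs : {for foot s, continuous (sect s)} by case: (sect_smooth s).
  apply: filterS2 (local_rep_near cs cb ct) (cinv_near cb (sect_near s)).
  move=> y [cy yK [_ ty]] piy; have [bb _] := bs.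
  by rewrite /= /F /local_rep (bchart_lsubmx bb ty) piy yK.
have [_ <-] := differentiable_linear v rsubmx_linear
  (linear_mx_continuous rsubmx_linear) dF.
have dfib := smooth_near_differentiable (sect_fib_smooth bs).
apply: (etrans (derive_delta v dfib)).
apply/rowP => l; rewrite summxE mxE; apply: eq_bigr => a _.
by rewrite !mxE.
Qed.

Lemma holE X b s : bchart_at b s -> hol pi X s b =
  row_mx (X (foot s) (bbase b)) (X (foot s) (bbase b) *m ju1 b s).
Proof. by move=> bs; rewrite /hol asboolT // diff_sect. Qed.

Lemma hol_out X b s : ~ bchart_at b s -> hol pi X s b = 0.
Proof. by move=> bs; rewrite /hol asboolF. Qed.

(** In bundle coordinates [pi] is the linear map [lsubmx], which is its own differential. *)
Lemma diff_bchart_proj b e v : is_bchart pi b -> cdom (btot b) e ->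
  'd (local_rep (btot b) (bbase b) pi) (cmap (btot b) e) v = lsubmx v.
Proof.
move=> bb be.
have [dl lE] := linear_derive (cmap (btot b) e) v (@lsubmx_linear R 1 m k)
  (linear_mx_continuous lsubmx_linear).
rewrite (near_eq_diff dl); first by rewrite -deriveE.
apply: filterS (chart_near (bchart_tot bb be)) => y [[_ cy] yK].
by rewrite /local_rep -(bchart_lsubmx bb cy) yK.
Qed.

(** Stated for any [X] related to [xi], so that uniqueness of such an [X] can be deduced from it. *)
Lemma GammaJ_hol (xi : E -> tvec R (m + k) E) X :
  related pi xi X -> GammaJ pi xi = hol pi X.
Proof.
move=> rX; apply/funext => s; apply/funext => b.
have [bs|nbs] := pselect (bchart_at b s); last first.
  by rewrite hol_out // /GammaJ asboolF.
have [bb be] := bs.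
rewrite holE // /GammaJ asboolT // -(diff_bchart_proj _ bb be).
by rewrite -(rX _ _ _ (bchart_tot bb be) (bchart_base bb be)) sect_foot.
Qed.

Lemma section_exists b e (A : 'M[R]_(m, k)) : is_bchart pi b -> cdom (btot b) e ->
  exists s : lsection pi, [/\ bchart_at b s, sect s (foot s) = e
    & jcoord b s = (cmap (btot b) e, A)].
Proof.
move=> bb be; have ce := bchart_tot bb be; have c0e := bchart_base bb be.
set c := btot b in be ce *; set c0 := bbase b in c0e *.
(* The intercept for which the affine graph [g] of slope [A] passes through [e]. *)
pose w := rsubmx (cmap c e) - cmap c0 (pi e) *m A.
pose g (y : 'rV[R]_m) := row_mx y (w + y *m A).
have sg y : smooth_near g y.
  have sid : smooth_near (fun z : 'rV[R]_m => z) y.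
    by apply: smooth_near_linear => // z; exact: cvg_id.
  apply: smooth_near_row_mx => //.
  apply: smooth_nearD; first exact: smooth_near_cst.
  by apply: smooth_near_mulmx => //; exact: smooth_near_cst.
have g0 : g (cmap c0 (pi e)) = cmap c e.
  by rewrite /g /w subrK -(bchart_lsubmx bb be) hsubmxK.
have [_ oI _ _ _] := atlas_is_chart (proj1 ce).
pose phi x := cinv c (g (cmap c0 x)).
(* The base points over which the affine graph stays inside the chart image, where [cinv c] is
   meaningful. *)
pose U := [set x | cdom c0 x /\ (cmap c @` cdom c) (g (cmap c0 x))].
have phiU x : U x -> [/\ cdom c (phi x), cmap c (phi x) = g (cmap c0 x)
    & pi (phi x) = x].
  move=> [cx [e' ce' ge']].
  have phiE : phi x = e' by rewrite /phi -ge' chartK //; exact: bchart_tot.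
  rewrite phiE; split => //.
  rewrite -(chartK (bchart_base bb ce')) -(bchart_lsubmx bb ce') ge' row_mxKl.
  by rewrite chartK //; split => //; case: c0e.
have chart0 x : U x -> chart_at x c0 by move=> [cx _]; split => //; case: c0e.
have oU : open U.
  rewrite openE => x Ux.
  have cg : {for x, continuous (g \o cmap c0)}.
    apply: continuous_comp; first exact: cmap_continuous (chart0 x Ux).
    exact: smooth_near_continuous.
  have gI : \forall x' \near x, (cmap c @` cdom c) (g (cmap c0 x')).
    by apply: cg; apply: open_nbhs_nbhs; split => //; case: Ux.
  by apply: filterS2 (chart_dom_nbhs (chart0 x Ux)) gI => x' [_ ?].
have sphi x : U x -> smooth_at phi x.
  move=> Ux; have [cx cphi piphi] := phiU x Ux; have c0x := chart0 x Ux.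
  have cphix : chart_at (phi x) c by exact: bchart_tot.
  split=> [|c1 c2 cx1 cx2].
    apply: (@continuous_comp _ _ _ (g \o cmap c0) (cinv c)).
      apply: continuous_comp; first exact: cmap_continuous.
      exact: smooth_near_continuous.
    by rewrite /= -cphi; exact: cinv_continuous.
  (* In arbitrary charts [phi] is [g] enclosed between two transition maps. *)
  change (smooth_near (local_rep c c2 id \o (g \o local_rep c1 c0 id)) (cmap c1 x)).
  apply: smooth_near_comp.
    apply: smooth_near_comp; last exact: sg.
    exact: local_rep_smooth (smooth_at_id x) cx1 c0x.
  rewrite /= local_repE // -cphi.
  exact: local_rep_smooth (smooth_at_id (phi x)) cphix cx2.
have Ue : U (pi e) by split; [case: c0e|rewrite g0; exists e].
have HU : exists U, [/\ open U, U (pi e), forall x, U x -> smooth_at phi x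
    & forall x, U x -> pi (phi x) = x].
  by exists U; split => // x /phiU[].
have phie : phi (pi e) = e by rewrite /phi g0 chartK.
exists (LSection HU); split => //=; first by split => //=; rewrite phie.
rewrite /jcoord /= phie; congr pair; apply/matrixP => a l.
rewrite mxE /=.
have dA (v : 'rV[R]_m) :
    'D_v (fun y : 'rV[R]_m => w + y *m A) (cmap c0 (pi e)) = v *m A.
  have lA : linear (fun y : 'rV[R]_m => y *m A).
    by move=> r y z; rewrite mulmxDl scalemxAl.
  have [dA AE] := linear_derive (cmap c0 (pi e)) v lA (linear_mx_continuous lA).
  apply: (etrans (deriveD (derivable_cst w _ v) (@diff_derivable _ _ _ _ _ _ dA))).
  by rewrite derive_cst add0r AE.
have -> : 'D_(delta_mx 0 a) (sect_fib b (LSection HU)) (cmap c0 (pi e))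
    = delta_mx 0 a *m A.
  rewrite -dA; apply: near_eq_derive.
  have gI : \forall y \near cmap c0 (pi e), (cmap c @` cdom c) (g y).
    apply: (smooth_near_continuous (sg (cmap c0 (pi e)))).
    by apply: open_nbhs_nbhs; split => //; case: Ue.
  apply: filterS2 (chart_near c0e) gI => y [_ yK] [e' ce' ge'].
  rewrite /sect_fib /local_rep /= /phi yK -ge' chartK ?ge' ?row_mxKr //.
  exact: bchart_tot.
by rewrite -rowE mxE.
Qed.

End bundle_charts.

(** * The prolongation bracket of holonomic lifts *)

Section hol_bracket.
Context {R : realType} {m k : nat} {M : manifold R m} {E : manifold R (m + k)}.
Context { pi : E -> M}.
Implicit Types (b : bchart M E) (s : lsection pi) (X Y : M -> tvec R m M).

Local Notation jet1 := ('rV[R]_(m + k) * 'M[R]_(m, k))%type.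

(** The lift in jet coordinates as an explicit formula that can be differentiated, whereas [jrep]
    goes through a chosen representative. *)
Definition hol_rep X b (q : jet1) : 'rV[R]_(m + k) :=
  let v := vrep X (bbase b) (lsubmx q.1) in row_mx v (v *m q.2).

Lemma hol_jcoord X b s : bchart_at b s -> hol pi X s b = hol_rep X b (jcoord b s).
Proof.
by move=> bs; rewrite holE // /hol_rep jcoord_lsubmx // vrepE //; exact: bchart_at_base.
Qed.

(** The representative chosen by [jrep] is harmless, since the lift depends on the jet coordinates
    alone. By [section_exists] there is one over every point of the chart, so the default value 0
    does not occur. *)
Lemma jrep_hol X b q : is_bchart pi b -> (cmap (btot b) @` cdom (btot b)) q.1 ->
  jrep b (fun s => hol pi X s b) q = hol_rep X b q.
Proof.
move=> bb [e be eq]; rewrite /jrep; case: pselect => [h|nh].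
  by case: (cid h) => s /= [bs <-]; exact: hol_jcoord.
have [s [bs _ js]] := section_exists q.2 bb be.
by case: nh; exists s; split => //; rewrite js eq; case: (q).
Qed.

Lemma jrep_hol_near X b s : bchart_at b s ->
  {near jcoord b s, jrep b (fun s => hol pi X s b) =1 hol_rep X b}.
Proof.
move=> bs; have [bb be] := bs.
have [_ oI _ _ _] := atlas_is_chart (proj1 (bchart_tot bb be)).
have nI : \forall y \near (jcoord b s).1, (cmap (btot b) @` cdom (btot b)) y.
  by apply: open_nbhs_nbhs; split => //; exists (sect s (foot s)).
have cfst : (fun q : jet1 => q.1) @ jcoord b s --> (jcoord b s).1 by exact: cvg_fst.
have nq : \forall q \near jcoord b s, (cmap (btot b) @` cdom (btot b)) q.1.
  exact: cfst.
by apply: filterS nq => q; exact: jrep_hol.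
Qed.

Lemma base_rep_smooth X b (q : jet1) : vfield X -> is_bchart pi b ->
  (cmap (btot b) @` cdom (btot b)) q.1 ->
  smooth_near (fun q : jet1 => vrep X (bbase b) (lsubmx q.1)) q.
Proof.
move=> vX bb [e be eq].
have lin : linear (fun q : jet1 => lsubmx q.1) by move=> a u v; rewrite /= linearP.
have cont : continuous (fun q : jet1 => lsubmx q.1).
  move=> z; apply: continuous_comp; first exact: cvg_fst.
  exact: linear_mx_continuous lsubmx_linear _.
apply: (smooth_near_linear_pre lin cont); rewrite -eq (bchart_lsubmx bb be).
exact: vfield_smooth vX (bchart_base bb be).
Qed.

Lemma snd_smooth (q : jet1) : smooth_near (fun q : jet1 => q.2) q.
Proof. by apply: smooth_near_linear => // z; exact: cvg_snd. Qed.

Lemma hol_rep_smooth X b (q : jet1) : vfield X -> is_bchart pi b ->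
  (cmap (btot b) @` cdom (btot b)) q.1 -> smooth_near (hol_rep X b) q.
Proof.
move=> vX bb qI; have sX := base_rep_smooth vX bb qI.
apply: smooth_near_row_mx => //; apply: smooth_near_mulmx => //.
exact: snd_smooth.
Qed.

Lemma generalized_field_hol X : vfield X -> generalized_field pi (hol pi X).
Proof.
move=> vX; split.
- split=> [s b|s b b' bs bs']; first exact: hol_out.
  have c0 := bchart_at_base bs; have c0' := bchart_at_base bs'.
  have ct := bchart_at_tot bs; have ct' := bchart_at_tot bs'.
  rewrite /hol !asboolT //.
  have -> : X (foot s) (bbase b') = 'd (local_rep (bbase b) (bbase b') id)
      (cmap (bbase b) (foot s)) (X (foot s) (bbase b)).
    exact: vfield_related_id vX _ _ _ c0 c0'.
  have ss := sect_smooth s.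
  (* From [sect s \o id = id \o sect s]: changing charts on the base and changing charts on [E]
     factor the same differential. *)
  apply: (etrans (esym (diff_local_rep_comp (X (foot s) (bbase b))
    (smooth_at_id (foot s)) ss c0 c0' ct'))).
  exact: (diff_local_rep_comp _ ss (smooth_at_id _) c0 ct ct').
- move=> s t [fst sst dst]; apply/funext => b.
  have bst : bchart_at b s <-> bchart_at b t by rewrite /bchart_at sst.
  have [bs|nbs] := pselect (bchart_at b s); last first.
    by rewrite !hol_out // => /bst.
  have bt := bst.1 bs; rewrite /hol !asboolT // -fst.
  exact: dst (bchart_at_base bs) (bchart_at_tot bs) _.
- by exists X => // s b bs; rewrite holE // row_mxKl.
- move=> b bb; apply: smooth_near_on => q qI.
  apply: smooth_near_eq (hol_rep_smooth vX bb qI).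
  have [ab _ _] := bb; have [_ oI _ _ _] := atlas_is_chart ab.
  have nI : \forall y \near q.1, (cmap (btot b) @` cdom (btot b)) y.
    exact: open_nbhs_nbhs.
  have cfst : (fun q : jet1 => q.1) @ q --> q.1 by exact: cvg_fst.
  have nq : \forall q' \near q, (cmap (btot b) @` cdom (btot b)) q'.1.
    exact: cfst.
  by apply: filterS nq => q' /(jrep_hol X bb) e; exact: esym e.
Qed.

Lemma derive_hol_rep X b (q : jet1) u A : vfield X -> is_bchart pi b ->
  (cmap (btot b) @` cdom (btot b)) q.1 ->
  let D := 'D_(lsubmx u) (vrep X (bbase b)) (lsubmx q.1) in
  'D_(u, A) (hol_rep X b) q =
    row_mx D (D *m q.2 + vrep X (bbase b) (lsubmx q.1) *m A).
Proof.
move=> vX bb qI D.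
have dh := smooth_near_differentiable (hol_rep_smooth vX bb qI).
pose V := fun q : jet1 => vrep X (bbase b) (lsubmx q.1).
have sV : smooth_near V q := base_rep_smooth vX bb qI.
have DV : 'D_(u, A) V q = D.
  have [e be eq] := qI.
  have lin : linear (fun q : jet1 => lsubmx q.1) by move=> a y z; rewrite /= linearP.
  have cont : continuous (fun q : jet1 => lsubmx q.1).
    move=> z; apply: continuous_comp; first exact: cvg_fst.
    exact: linear_mx_continuous lsubmx_linear _.
  have [dl lE] := linear_derive q (u, A) lin cont.
  have dX : differentiable (vrep X (bbase b)) (lsubmx q.1).
    rewrite -eq (bchart_lsubmx bb be).
    exact/smooth_near_differentiable/(vfield_smooth vX)/bchart_base.
  by apply: (etrans (derive_comp (u, A) dl dX)); rewrite lE.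
rewrite -[LHS]hsubmxK; congr row_mx.
  have [_ <-] := differentiable_linear (u, A) lsubmx_linear
    (linear_mx_continuous lsubmx_linear) dh.
  have -> : lsubmx \o hol_rep X b = V.
    by apply/funext => z; rewrite /= row_mxKl.
  exact: DV.
have [_ <-] := differentiable_linear (u, A) rsubmx_linear
  (linear_mx_continuous rsubmx_linear) dh.
have -> : rsubmx \o hol_rep X b = (fun q => V q *m q.2).
  by apply/funext => z; rewrite /= row_mxKr.
have d2 := smooth_near_differentiable (snd_smooth q).
have dV2 := smooth_near_differentiable (smooth_near_mulmx sV (snd_smooth q)).
apply: (etrans (derive_mulmx (u, A) (smooth_near_differentiable sV) d2 dV2)).
have lin2 : linear (fun q : jet1 => q.2) by [].
have cont2 : continuous (fun q : jet1 => q.2) by move=> z; exact: cvg_snd.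
have [_ D2] := linear_derive q (u, A) lin2 cont2.
by rewrite DV D2.
Qed.

(** Where no jet has the coordinates [q], [jrep] takes its default value 0 and both terms vanish as
    well. The equality of functions is thus global, and derivatives follow at once. *)
Lemma characteristic_hol X b l : characteristic b (hol pi X) l = (fun=> 0).
Proof.
apply/funext => q; rewrite /characteristic /jrep; case: pselect => [h|nh].
  case: (cid h) => s /= [bs <-]; rewrite holE // row_mxEr mxE.
  rewrite -sumrB big1 // => c _; rewrite row_mxEl; exact: subrr.
rewrite mxE big1 ?subr0 // => c _; rewrite mxE; exact: mul0r.
Qed.

Lemma prol_coef_hol X b s a l : bchart_at b s -> prol_coef b (hol pi X) s a l =
  \sum_(c < m) X (foot s) (bbase b) 0 c * ju2 b s c a l.
Proof.
move=> bs; rewrite /prol_coef characteristic_hol /total_derivative.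
rewrite /pdx /pdu /pdu1 derive_cst.
rewrite big1 => [|l' _]; last by rewrite derive_cst mulr0.
rewrite big1 => [|c _]; last first.
  by apply: big1 => l' _; rewrite derive_cst mulr0.
rewrite !add0r; apply: eq_bigr => c _.
by rewrite holE // row_mxEl.
Qed.

(** The three sums expand the linear map ['d f] in the standard basis of the jet coordinates. As a
    single directional derivative the prolongation is open to the product rule. *)
Lemma prolongation_derive (xi : lsection pi -> bchart M E -> 'rV[R]_(m + k)) b s
    (f : jet1 -> R) : differentiable f (jcoord b s) ->
  prolongation b xi s f =
  'D_(xi s b, \matrix_(a, l) prol_coef b xi s a l) f (jcoord b s).
Proof.
move=> df; rewrite /prolongation /pdx /pdu /pdu1.
set P := \matrix_(a, l) _; set q := jcoord b s in df *.
pose G : jet1 -> R := 'd f q.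
have GD (y z : jet1) : G (y + z) = G y + G z by exact: linearD.
have GL (a : R) (y z : jet1) : G (a *: y + z) = a *: G y + G z by exact: linearP.
have DG (z : jet1) : 'D_z f q = G z by exact: deriveE.
have l1 : linear (fun u : 'rV[R]_m => G (row_mx u 0, 0)).
  move=> a u v; rewrite -GL; congr (G (_, _)); last by rewrite /= scaler0 addr0.
  by rewrite /= scale_row_mx add_row_mx scaler0 addr0.
have l2 : linear (fun u : 'rV[R]_k => G (row_mx 0 u, 0)).
  move=> a u v; rewrite -GL; congr (G (_, _)); last by rewrite /= scaler0 addr0.
  by rewrite /= scale_row_mx add_row_mx scaler0 addr0.
have l3 : linear (fun A : 'M[R]_(m, k) => G (0, A)).
  by move=> a A B; rewrite -GL; congr (G (_, _)); rewrite /= scaler0 addr0.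
have decomp : (xi s b, P) = (row_mx (lsubmx (xi s b)) 0, 0)
    + (row_mx 0 (rsubmx (xi s b)), 0) + (0, P) :> jet1.
  congr pair; rewrite /= ?addr0 ?add0r //.
  by rewrite add_row_mx add0r addr0 hsubmxK.
rewrite DG decomp !GD; congr (_ + _ + _).
- rewrite (linear_mx_sum _ l1) big_ord1; apply: eq_bigr => a _.
  by rewrite DG mxE.
- rewrite (linear_mx_sum _ l2) big_ord1; apply: eq_bigr => l _.
  by rewrite DG mxE.
- rewrite (linear_mx_sum _ l3); apply: eq_bigr => a _; apply: eq_bigr => l _.
  by rewrite DG mxE.
Qed.

Lemma ju2_sym b s a c l : bchart_at b s -> ju2 b s a c l = ju2 b s c a l.
Proof.
move=> bs; have := derive_comm (delta_mx 0 a) (delta_mx 0 c) (sect_fib_smooth bs).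
exact: (congr1 (fun A : 'rV[R]_k => A 0 l)).
Qed.

Lemma pro_bracket_hol X Y : vfield X -> vfield Y ->
  pro_bracket pi (hol pi X) (hol pi Y) = hol pi (lie_bracket X Y).
Proof.
move=> vX vY; apply/funext => s; apply/funext => b.
have [bs|nbs] := pselect (bchart_at b s); last first.
  by rewrite hol_out // /pro_bracket asboolF.
have [bb be] := bs; have cb := bchart_at_base bs.
rewrite /pro_bracket asboolT //.
have qI : (cmap (btot b) @` cdom (btot b)) (jcoord b s).1.
  by exists (sect s (foot s)).
(* The prolongation coefficients of the lift of [Z], in the form given by [prol_coef_hol]. *)
pose J (Z : M -> tvec R m M) : 'M[R]_(m, k) :=
  \matrix_(a, l) \sum_(c < m) Z (foot s) (bbase b) 0 c * ju2 b s c a l.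
pose D (Z T : M -> tvec R m M) := 'D_(Z (foot s) (bbase b)) (vrep T (bbase b))
  (cmap (bbase b) (foot s)).
have half Z T i : vfield Z -> vfield T ->
    prolongation b (hol pi Z) s (fun q => jrep b (fun t => hol pi T t b) q 0 i) =
    row_mx (D Z T) (D Z T *m ju1 b s + T (foot s) (bbase b) *m J Z) 0 i.
  move=> vZ vT.
  have sT := hol_rep_smooth vT bb qI.
  have dT := smooth_near_differentiable sT.
  have dTi := smooth_near_differentiable (smooth_near_coord 0 i sT).
  (* The prolongation differentiates [jrep]; agreement near the jet allows the explicit formula in
     its place. *)
  have nT : {near jcoord b s, (fun q => hol_rep T b q 0 i) =1
                              (fun q => jrep b (fun t => hol pi T t b) q 0 i)}.
    by apply: filterS (jrep_hol_near T bs) => q e; rewrite e.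
  rewrite prolongation_derive; last exact: near_eq_differentiable nT dTi.
  apply: (etrans (esym (near_eq_derive _ nT))).
  apply: (etrans (derive_coord _ 0 i dT)).
  rewrite (derive_hol_rep _ _ vT bb qI) jcoord_lsubmx // holE // row_mxKl.
  rewrite vrepE //; congr (row_mx _ (_ + _ *m _) 0 i).
  by apply/matrixP => a l; rewrite !mxE prol_coef_hol.
rewrite holE // lie_bracketE //.
have sym : Y (foot s) (bbase b) *m J X = X (foot s) (bbase b) *m J Y.
  apply/rowP => l; rewrite !mxE.
  under eq_bigr do rewrite mxE mulr_sumr.
  under [RHS]eq_bigr do rewrite mxE mulr_sumr.
  rewrite exchange_big; apply: eq_bigr => a _; apply: eq_bigr => c _.
  by rewrite mulrCA (ju2_sym c a l bs).
have -> : ebracket (vrep X (bbase b)) (vrep Y (bbase b)) (cmap (bbase b) (foot s))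
    = D X Y - D Y X by rewrite /ebracket !vrepE.
transitivity (row_mx (D X Y) (D X Y *m ju1 b s + Y (foot s) (bbase b) *m J X)
   - row_mx (D Y X) (D Y X *m ju1 b s + X (foot s) (bbase b) *m J Y)).
  by apply/rowP => i; rewrite mxE half // half // [RHS]mxE [X in _ = _ + X]mxE.
rewrite opp_row_mx add_row_mx; congr row_mx.
by rewrite sym mulmxBl opprD addrACA subrr addr0.
Qed.

End hol_bracket.

(** * Bundle charts and projectable fields *)

Lemma row_mx_continuous (R : realType) (T : topologicalType) m n1 n2
    (f : T -> 'M[R]_(m, n1)) (g : T -> 'M[R]_(m, n2)) x :
  {for x, continuous f} -> {for x, continuous g} ->
  {for x, continuous (fun y => row_mx (f y) (g y))}.
Proof.
move=> cf cg.
have lf : linear (fun A : 'M[R]_(m, n1) => row_mx A (0 : 'M[R]_(m, n2))).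
  by move=> a A B; rewrite scale_row_mx add_row_mx scaler0 addr0.
have lg : linear (fun A : 'M[R]_(m, n2) => row_mx (0 : 'M[R]_(m, n1)) A).
  by move=> a A B; rewrite scale_row_mx add_row_mx scaler0 addr0.
have -> : (fun y => row_mx (f y) (g y)) =
    (fun y => row_mx (f y) 0 + row_mx 0 (g y)).
  by apply/funext => y; rewrite add_row_mx addr0 add0r.
have c1 : {for x, continuous (fun y => row_mx (f y) (0 : 'M[R]_(m, n2)))}.
  exact: (continuous_comp cf (linear_mx_continuous lf (x := f x))).
have c2 : {for x, continuous (fun y => row_mx (0 : 'M[R]_(m, n1)) (g y))}.
  exact: (continuous_comp cg (linear_mx_continuous lg (x := g x))).
exact: cvgD c1 c2.
Qed.

(** The product of a chart at [pi e] and a chart at the fibre point [pr e], read through a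
    trivialization. It belongs to the atlas of [E] by maximality, after compatibility with every
    chart has been checked. *)
Lemma bchart_exists (R : realType) (m k : nat) (M : manifold R m)
    (E : manifold R (m + k)) (pi : E -> M) (e : E) : smooth_bundle pi ->
  exists b : bchart M E, is_bchart pi b /\ cdom (btot b) e.
Proof.
case=> spi _ [F triv].
have [U [pr [glue [Ue [oU spr sglue glueK piK]]]]] := triv (pi e).
have [c0 [ac0 c0e]] := atlas_cover (pi e).
have [d [ad de]] := atlas_cover (pr e).
pose W := [set x | U (pi x) /\ cdom c0 (pi x) /\ cdom d (pr x)].
pose cm (x : E) : 'rV[R]_(m + k) := row_mx (cmap c0 (pi x)) (cmap d (pr x)).
pose ci (y : 'rV[R]_(m + k)) := glue (cinv c0 (lsubmx y)) (cinv d (rsubmx y)).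
have W0 x : W x -> chart_at (pi x) c0 by move=> [_ []].
have Wd x : W x -> chart_at (pr x) d by move=> [_ []].
have ciK x : W x -> ci (cm x) = x.
  move=> Wx; have [Ux _] := Wx.
  by rewrite /ci /cm row_mxKl row_mxKr (chartK (W0 _ Wx)) (chartK (Wd _ Wx)) piK.
have cpi x : {for x, continuous pi} by case: (spi x).
have cpr x : W x -> {for x, continuous pr} by move=> [Ux _]; case: (spr x Ux).
have nU x : W x -> \forall z \near pi x, U z.
  by move=> [Ux _]; exact: open_nbhs_nbhs.
have oW : open W.
  rewrite openE => x Wx.
  have n1 : \forall z \near x, U (pi z) by exact: cpi (nU x Wx).
  have n2 : \forall z \near x, chart_at (pi z) c0.
    exact: cpi (chart_dom_nbhs (W0 x Wx)).
  have n3 : \forall z \near x, chart_at (pr z) d.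
    exact: cpr Wx _ (chart_dom_nbhs (Wd x Wx)).
  by apply: filterS3 n1 n2 n3 => z ? [_ ?] [_ ?].
(* That [ci] is a right inverse near [cm x] with values in [W] gives openness of the chart image. *)
have nW x : W x -> \forall y \near cm x, W (ci y) /\ cm (ci y) = y.
  move=> Wx; have [c0x dx] := (W0 x Wx, Wd x Wx).
  have ll : (lsubmx : 'rV[R]_(m + k) -> _) @ cm x --> cmap c0 (pi x).
    rewrite -[X in _ --> X](row_mxKl (cmap c0 (pi x)) (cmap d (pr x))).
    exact: linear_mx_continuous lsubmx_linear _.
  have rr : (rsubmx : 'rV[R]_(m + k) -> _) @ cm x --> cmap d (pr x).
    rewrite -[X in _ --> X](row_mxKr (cmap c0 (pi x)) (cmap d (pr x))).
    exact: linear_mx_continuous rsubmx_linear _.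
  have n1 : \forall y \near cm x, chart_at (cinv c0 (lsubmx y)) c0 /\
      cmap c0 (cinv c0 (lsubmx y)) = lsubmx y by exact: ll (chart_near c0x).
  have n2 : \forall y \near cm x, U (cinv c0 (lsubmx y)).
    exact: ll (cinv_near c0x (nU x Wx)).
  have n3 : \forall y \near cm x, chart_at (cinv d (rsubmx y)) d /\
      cmap d (cinv d (rsubmx y)) = rsubmx y by exact: rr (chart_near dx).
  apply: filterS3 n1 n2 n3 => y [[_ c0y] c0K] Uy [[_ dy] dK].
  have [pig prg] := glueK (cinv c0 (lsubmx y)) (cinv d (rsubmx y)) Uy.
  by rewrite /W /= /cm /ci pig prg c0K dK hsubmxK.
pose c := Chart W cm ci.
have cc : is_chart c.
  split => //= [|x Wx|x Wx].
  - rewrite openE => _ [x Wx <-].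
    by apply: filterS (nW x Wx) => y [Wy <-]; exists (ci y).
  - apply: row_mx_continuous.
      exact: (continuous_comp (cpi x) (cmap_continuous (W0 x Wx))).
    exact: (continuous_comp (cpr x Wx) (cmap_continuous (Wd x Wx))).
  - have [Ux _] := Wx; have [cg _] := sglue (pi x) (pr x) Ux.
    have c0i : {for lsubmx (cm x), continuous (cinv c0)}.
      by rewrite row_mxKl; exact: cinv_continuous (W0 x Wx).
    have di : {for rsubmx (cm x), continuous (cinv d)}.
      by rewrite row_mxKr; exact: cinv_continuous (Wd x Wx).
    have ll : {for cm x, continuous (lsubmx : 'rV[R]_(m + k) -> _)}.
      exact: linear_mx_continuous lsubmx_linear _.
    have rr : {for cm x, continuous (rsubmx : 'rV[R]_(m + k) -> _)}.
      exact: linear_mx_continuous rsubmx_linear _.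
    have c1 := continuous_comp ll c0i; have c2 := continuous_comp rr di.
    have cp : {for cm x, continuous (fun y => (cinv c0 (lsubmx y), cinv d (rsubmx y)))}.
      exact: cvg_pair c1 c2.
    have cg' : {for (cinv c0 (lsubmx (cm x)), cinv d (rsubmx (cm x))),
        continuous (fun z => glue z.1 z.2)}.
      by rewrite row_mxKl row_mxKr (chartK (W0 x Wx)) (chartK (Wd x Wx)).
    exact: (continuous_comp cp cg').
have ac : atlas c.
  apply: atlas_maximal => // c' ac'; split; apply: smooth_near_on.
    move=> _ [x [Wx c'x] <-] /=; have [Ux _] := Wx.
    have c'x' : chart_at (glue (pi x) (pr x)) c' by rewrite piK.
    have [_ sg] := sglue (pi x) (pr x) Ux.
    have {}sg := sg c0 d c' (W0 x Wx) (Wd x Wx) c'x'.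
    (* Smoothness of [glue] is expressed on a product of row spaces; [L] splits a row
       accordingly. *)
    pose L (y : 'rV[R]_(m + k)) := (lsubmx y, rsubmx y).
    have lL : linear L by move=> a y z; rewrite /L !linearP.
    have cL : continuous L.
      move=> y.
      have ll : (lsubmx : 'rV[R]_(m + k) -> _) @ y --> lsubmx y.
        exact: linear_mx_continuous lsubmx_linear _.
      have rr : (rsubmx : 'rV[R]_(m + k) -> _) @ y --> rsubmx y.
        exact: linear_mx_continuous rsubmx_linear _.
      exact: cvg_pair ll rr.
    apply: (smooth_near_linear_pre (x := cm x) lL cL
      (f := fun z => cmap c' (glue (cinv c0 z.1) (cinv d z.2)))).
    by rewrite /L row_mxKl row_mxKr; exact: sg.
  move=> _ [x [Wx c'x] <-]; have [Ux _] := Wx; have c'xx : chart_at x c' by [].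
  (* The opposite transition map has the local representatives of [pi] and [pr] as its blocks. *)
  change (smooth_near (fun y => row_mx (local_rep c' c0 pi y) (local_rep c' d pr y))
    (cmap c' x)).
  apply: smooth_near_row_mx.
    exact: local_rep_smooth (spi x) c'xx (W0 x Wx).
  exact: local_rep_smooth (spr x Ux) c'xx (Wd x Wx).
exists (BChart c c0); split; last by split.
split => // x Wx; split; first by case: (W0 x Wx).
exact: row_mxKl.
Qed.

(** * Injectivity of the lift and projection of fields to the base *)

Section bundle.
Context {R : realType} {m k : nat} {M : manifold R m} {E : manifold R (m + k)}.
Context { pi : E -> M}.
Hypothesis bundle_pi : smooth_bundle pi.
Implicit Types (xi eta : E -> tvec R (m + k) E) (X Y : M -> tvec R m M).

Let smooth_pi p : smooth_at pi p.
Proof. by case: bundle_pi => H _ _; exact: H. Qed.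

Let surj_pi x : exists e, pi e = x.
Proof. by case: bundle_pi => _ H _; exact: H. Qed.

(** The components are compared in the base chart of a bundle chart; the transformation law of
    tangent vectors carries the equality to any other chart at [p]. *)
Lemma hol_inj X Y : vfield X -> vfield Y -> hol pi X = hol pi Y -> X = Y.
Proof.
move=> vX vY XY; apply/funext => p; apply/funext => c.
have [cp|ncp] := pselect (chart_at p c); last by rewrite !vfield_out.
have [e ep] := surj_pi p; have [b [bb be]] := bchart_exists e bundle_pi.
(* The slope 0 is arbitrary: the lift at any jet over [e] shows the base components. *)
have [s [bs se _]] := section_exists 0 bb be.
have sp : foot s = p by rewrite -sect_foot se.
have Eb : X p (bbase b) = Y p (bbase b).
  have := congr1 (fun H => lsubmx (H s b)) XY.
  by rewrite /= !holE // !row_mxKl sp.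
have cb : chart_at p (bbase b) by rewrite -ep; exact: bchart_base.
rewrite (vfield_related_id vX cb cp).
by apply: (etrans _ (esym (vfield_related_id vY cb cp))); rewrite Eb.
Qed.

(** Both fields have the same lift, namely [GammaJ pi xi]. *)
Lemma related_unique xi X Y : vfield X -> vfield Y ->
  related pi xi X -> related pi xi Y -> X = Y.
Proof.
move=> vX vY rX rY; apply: hol_inj => //.
by rewrite -(GammaJ_hol rX) -(GammaJ_hol rY).
Qed.

Lemma base_fieldP xi : projectable pi xi ->
  vfield (base_field pi xi) /\ related pi xi (base_field pi xi).
Proof.
move=> [_ [X vX rX]].
exact: (@xgetPex _ 0 [set X | vfield X /\ related pi xi X] (ex_intro _ X (conj vX rX))).
Qed.

Lemma base_field_vfield xi : projectable pi xi -> vfield (base_field pi xi).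
Proof. by move=> /base_fieldP[]. Qed.

Lemma base_field_related xi : projectable pi xi -> related pi xi (base_field pi xi).
Proof. by move=> /base_fieldP[]. Qed.

Lemma base_fieldE xi X : vfield xi -> vfield X -> related pi xi X ->
  base_field pi xi = X.
Proof.
move=> vxi vX rX.
have [] : vfield (base_field pi xi) /\ related pi xi (base_field pi xi).
  by apply: base_fieldP; split => //; exists X.
by move=> v r; exact: (related_unique (xi := xi)).
Qed.

Lemma GammaJ_base_field xi : projectable pi xi ->
  GammaJ pi xi = hol pi (base_field pi xi).
Proof. by move=> pxi; apply: GammaJ_hol; exact: base_field_related. Qed.

Lemma projectable_bracket xi eta : projectable pi xi -> projectable pi eta ->
  projectable pi (lie_bracket xi eta) /\
  base_field pi (lie_bracket xi eta) =
    lie_bracket (base_field pi xi) (base_field pi eta).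
Proof.
move=> pxi peta; have [vxi _] := pxi; have [veta _] := peta.
have [vX rX] := base_fieldP pxi; have [vY rY] := base_fieldP peta.
have vb := vfield_bracket vxi veta; have vB := vfield_bracket vX vY.
have rb := related_bracket smooth_pi vxi veta vX vY rX rY.
by split; [split => //; exists (lie_bracket (base_field pi xi) (base_field pi eta))
  |exact: base_fieldE].
Qed.

Lemma projectable_linear (a : R) xi eta : projectable pi xi -> projectable pi eta ->
  projectable pi (a *: xi + eta) /\
  base_field pi (a *: xi + eta) = a *: base_field pi xi + base_field pi eta.
Proof.
move=> pxi peta; have [vxi _] := pxi; have [veta _] := peta.
have [vX rX] := base_fieldP pxi; have [vY rY] := base_fieldP peta.
have vb := vfield_linear a vxi veta; have vB := vfield_linear a vX vY.
have rb := related_linear a rX rY.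
by split; [split => //; exists (a *: base_field pi xi + base_field pi eta)
  |exact: base_fieldE].
Qed.

Lemma projectable_lie_algebra : lie_algebra (projectable pi) lie_bracket.
Proof.
apply: (lie_algebra_sub (vfield_lie_algebra E)).
- by move=> xi [].
- by split; [exact: vfield0|exists 0; [exact: vfield0|exact: related0]].
- by move=> a xi eta pxi peta; have [] := projectable_linear a pxi peta.
- by move=> xi eta pxi peta; have [] := projectable_bracket pxi peta.
Qed.

Lemma base_field_homomorphism :
  lie_homomorphism (projectable pi) lie_bracket lie_bracket (base_field pi).
Proof.
split=> [a xi eta pxi peta|xi eta pxi peta].
  by have [] := projectable_linear a pxi peta.
by have [] := projectable_bracket pxi peta.
Qed.

Lemma hol_linear (a : R) X Y : hol pi (a *: X + Y) = a *: hol pi X + hol pi Y.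
Proof.
apply/funext => s; apply/funext => b.
transitivity (a *: hol pi X s b + hol pi Y s b) => //.
rewrite /hol; case: asboolP => _; last by rewrite scaler0 addr0.
exact: linearP.
Qed.

Lemma GammaJ_homomorphism :
  lie_homomorphism (projectable pi) lie_bracket (pro_bracket pi) (GammaJ pi).
Proof.
split=> [a xi eta pxi peta|xi eta pxi peta].
  have [pl bl] := projectable_linear a pxi peta.
  by rewrite !GammaJ_base_field // bl hol_linear.
have [pb bb] := projectable_bracket pxi peta.
by rewrite !GammaJ_base_field // bb pro_bracket_hol //; exact: base_field_vfield.
Qed.

End bundle.

(** The isomorphism of the last clause is taken on the image of [pi_*], which is the quotient of the
    projectable fields by the vertical ones; the fourth clause identifies these as the kernel of
    [GammaJ]. *)
Theorem proposition1 (R : realType) (m k : nat) (M : manifold R m)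
    (E : manifold R (m + k)) (pi : E -> M) (bundle_pi : smooth_bundle pi) :
  let gamma_image := GammaJ pi @` projectable pi in
  [/\ lie_algebra (projectable pi) lie_bracket /\
      lie_algebra gamma_image (pro_bracket pi),
      forall xi, projectable pi xi ->
        generalized_field pi (GammaJ pi xi) /\
        GammaJ pi xi = hol pi (base_field pi xi),
      lie_homomorphism (projectable pi) lie_bracket (pro_bracket pi)
        (GammaJ pi) /\
      (forall xi eta, projectable pi xi -> projectable pi eta ->
        [/\ pro_bracket pi (GammaJ pi xi) (GammaJ pi eta)
            = pro_bracket pi (hol pi (base_field pi xi))
                (hol pi (base_field pi eta)),
            pro_bracket pi (hol pi (base_field pi xi))
                (hol pi (base_field pi eta))
            = hol pi (base_field pi (lie_bracket xi eta)) &
            hol pi (base_field pi (lie_bracket xi eta))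
            = GammaJ pi (lie_bracket xi eta)]),
      forall xi, projectable pi xi -> (GammaJ pi xi = 0 <-> vertical pi xi) &
      lie_isomorphism (base_field pi @` projectable pi) lie_bracket
        gamma_image (pro_bracket pi) (hol pi)].
Proof.
move=> gamma_image.
have GE xi : projectable pi xi -> GammaJ pi xi = hol pi (base_field pi xi).
  exact: GammaJ_base_field.
have hom := GammaJ_homomorphism bundle_pi.
have alg := projectable_lie_algebra bundle_pi.
have alg_gamma := lie_algebra_image alg hom.
have vb xi : projectable pi xi -> vfield (base_field pi xi).
  exact: base_field_vfield.
split.
- by split.
- move=> xi pxi; split; last exact: GE.
  by rewrite (GE xi pxi); exact/generalized_field_hol/vb.
- split=> [|xi eta pxi peta]; first exact: hom.
  have [pb bE] := projectable_bracket bundle_pi pxi peta.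
  split; [by rewrite (GE xi pxi) (GE eta peta)| |by rewrite (GE _ pb)].
  by rewrite bE; exact: pro_bracket_hol (vb xi pxi) (vb eta peta).
- move=> xi pxi; rewrite (GE xi pxi).
  have hol0 : hol pi 0 = 0.
    by have := hol_linear (pi := pi) (-1) 0 0; rewrite scaler0 addr0 scaleN1r addNr.
  (* Verticality is relatedness to the zero field, so injectivity of the lift and uniqueness of the
     projection translate it into [base_field pi xi = 0]. *)
  split=> [h0|ver].
    have vX0 := vfield0 M; have hE := etrans h0 (esym hol0).
    rewrite /vertical -(hol_inj bundle_pi (vb _ pxi) vX0 hE).
    exact: base_field_related.
  have [vxi _] := pxi.
  by rewrite (base_fieldE bundle_pi vxi (vfield0 M) ver).
- split; [|exact: alg_gamma| |].
  + exact: lie_algebra_image alg (base_field_homomorphism bundle_pi).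
  + split=> [a X Y _ _|_ _ [xi pxi <-] [eta peta <-]]; first exact: hol_linear.
    exact: esym (pro_bracket_hol (vb xi pxi) (vb eta peta)).
  + split.
    * by move=> _ [xi pxi <-]; exists xi; [|exact: GE].
    * move=> X Y /set_mem[xi pxi <-] /set_mem[eta peta <-].
      exact: hol_inj bundle_pi _ _ (vb xi pxi) (vb eta peta).
    * move=> _ [xi pxi <-]; exists (base_field pi xi); last exact: esym (GE xi pxi).
      by exists xi.
Qed.
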